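(* Let $\Omega\subset\mathbb{X}$ be convex and compact, $\kappa$ a positive integer, $\mathcal{F}=\{X\in\Omega:\mathrm{rank}(X)\le\kappa\}\ne\emptyset$, and $\mathcal{F}^*$ the set of global minimizers of $f$ over $\mathcal{F}$. Suppose that the multifunction $\Gamma(\omega)=\{X\in\Omega:\sum_{i=\kappa+1}^n\sigma_i(X)=\omega\}$, $\omega\in\mathbb{R}$, is calm at $0$ for each $X\in\Gamma(0)$, and that $f:\mathbb{X}\to\mathbb{R}$ is a smooth convex function such that $$\vartheta:=\inf_{X\in\mathcal{F},\,Y\in\mathcal{F}^*,\,X\ne Y}\frac{f(X)-f(Y)-\langle\nabla f(Y),X-Y\rangle}{\|X-Y\|_F^2}>0.$$ Then there exists a constant $c>0$ such that for any $X\in\Omega$, $$\mathrm{dist}(X,\mathcal{F}^* )\le c\sum_{i=\kappa+1}^n\sigma_i(X)+\frac{1}{\vartheta}\|\nabla f(\Pi_{\mathcal{F}}(X))-\nabla f(X^* )\|_F,$$ where $X^*$ is an arbitrary point of $\mathcal{F}^*$. Moreover, the constant $c$ can be specified as follows: (i) $c=\sqrt{1+c_u^2/c_l^2}$ when $\mathcal{F}=\{X\in\mathbb{R}^{n_1\times n_2}:\mathrm{rank}(X)\le\kappa,\ |\!|\!|X|\!|\!|\le\gamma\}$ (with $\Omega=\{X\in\mathbb{R}^{n_1\times n_2}:|\!|\!|X|\!|\!|\le\gamma\}$); (ii) $c=\sqrt{2}$ when $\mathcal{F}=\{X\in\mathbb{H}^n_+:\mathrm{rank}(X)\le\kappa,\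 \mathrm{tr}(X)=1\}$ (with $\Omega=\{X\in\mathbb{H}^n_+:\mathrm{tr}(X)=1\}$); (iii) $c=1+2n$ when $\mathcal{F}=\{X\in\mathbb{H}^n_+:\mathrm{rank}(X)\le\kappa,\ \mathrm{diag}(X)=e\}$ (with $\Omega=\{X\in\mathbb{H}^n_+:\mathrm{diag}(X)=e\}$).
   Context: $\mathbb{X}$ denotes either $\mathbb{R}^{n_1\times n_2}$ (with $n=\min(n_1,n_2)$) or the space $\mathbb{H}^n$ of $n\times n$ Hermitian matrices, endowed with the trace inner product $\langle\cdot,\cdot\rangle$ and its induced Frobenius norm $\|\cdot\|_F$; $\mathrm{dist}$ is the distance in $\|\cdot\|_F$. $\mathbb{H}^n_+$ is the cone of Hermitian positive semidefinite matrices. $\sigma_1(X)\ge\cdots\ge\sigma_n(X)\ge0$ are the singular values of $X$; empty sums are $0$. $\Pi_{\mathcal{F}}(X)$ denotes a projection point (a nearest point in $\|\cdot\|_F$) of $X$ onto the closed set $\mathcal{F}$. In (i), $|\!|\!|\cdot|\!|\!|$ is a norm on $\mathbb{R}^{n_1\times n_2}$, $\gamma>0$, and $c_l,c_u>0$ are constants with $c_l\|\cdot\|_F\le|\!|\!|\cdot|\!|\!|\le c_u\|\cdot\|_F$. In (iii), $e\in\mathbb{R}^n$ is the all-ones vector and $\mathrm{diag}(X)$ is the vector of diagonal entries of $X$. Calmness: a multifunction $\Upsilon:\mathbb{Y}\rightrightarrows\mathbb{Z}$ between finite dimensional normed spaces is calm at $\overline{y}$ for $\overline{z}\in\Upsilon(\overline{y})$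 if there exist $\alpha\ge0$ and neighborhoods $\mathcal{U}$ of $\overline{y}$, $\mathcal{V}$ of $\overline{z}$ such that $\Upsilon(y)\cap\mathcal{V}\subseteq\Upsilon(\overline{y})+\alpha\|y-\overline{y}\|\mathbb{B}_{\mathbb{Z}}$ for all $y\in\mathcal{U}$, where $\mathbb{B}_{\mathbb{Z}}$ is the closed unit ball of $\mathbb{Z}$ centered at the origin. *)

(* Defs.v *)
From HB Require Import structures.
From mathcomp Require Import all_boot all_order all_algebra sesquilinear spectral.
From mathcomp Require Import complex.
From mathcomp Require Import all_classical all_reals all_analysis.
From mathcomp Require Import ring lra.

Set Implicit Arguments.
Unset Strict Implicit.
Unset Printing Implicit Defensive.
Import Order.TTheory GRing.Theory Num.Theory.
Import numFieldNormedType.Exports.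

Local Open Scope classical_set_scope.
Local Open Scope ring_scope.
Local Open Scope sesquilinear_scope.
Local Open Scope complex_scope.

(* Hermitian matrices form a vector space over R only, not over R[i]; the norm
   put on [hermx R n] below is the Frobenius norm. *)

Record hermx (R : realType) (n : nat) := Hermx {
  hermval :> 'M[R[i]]_n ;
  hermvalP : hermval \is hermsymmx }.

HB.instance Definition _ R n := [isSub for @hermval R n].
HB.instance Definition _ R n := [Choice of hermx R n by <:].

Section hermx_lmodule.
Variables (R : realType) (n : nat).
Implicit Types (A B : hermx R n) (a b : R).

Lemma hermsymE (M : 'M[R[i]]_n) : (M \is hermsymmx) = (M == M ^t*).
Proof. by rewrite qualifE /= expr0 scale1r. Qed.

Lemma hermE A : A ^t* = A :> 'M[R[i]]_n.
Proof. by have := hermvalP A; rewrite hermsymE => /eqP {2}->. Qed.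

Fact hermx0_subproof : (0 : 'M[R[i]]_n) \is hermsymmx.
Proof. by rewrite hermsymE trmx0 map_mx0. Qed.

Fact hermxD_subproof A B : (hermval A + hermval B) \is hermsymmx.
Proof. by rewrite hermsymE linearD /= map_mxD !hermE. Qed.

Fact hermxN_subproof A : (- hermval A) \is hermsymmx.
Proof. by rewrite hermsymE linearN /= map_mxN !hermE. Qed.

Fact hermxZ_subproof a A : (a%:C *: hermval A) \is hermsymmx.
Proof.
rewrite hermsymE linearZ /= map_mxZ hermE; apply/eqP; congr (_ *: _).
by apply/esym/CrealP; rewrite complex_real.
Qed.

Let addh A B := Hermx (hermxD_subproof A B).
Let opph A := Hermx (hermxN_subproof A).
Let zeroh := Hermx hermx0_subproof.
Let scaleh a A := Hermx (hermxZ_subproof a A).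

Fact addhA : associative addh.
Proof. by move=> A B C; apply/val_inj; rewrite /= addrA. Qed.
Fact addhC : commutative addh.
Proof. by move=> A B; apply/val_inj; rewrite /= addrC. Qed.
Fact add0h : left_id zeroh addh.
Proof. by move=> A; apply/val_inj; rewrite /= add0r. Qed.
Fact addNh : left_inverse zeroh opph addh.
Proof. by move=> A; apply/val_inj; rewrite /= addNr. Qed.

HB.instance Definition _ :=
  GRing.isZmodule.Build (hermx R n) addhA addhC add0h addNh.

Fact scalehA a b A : scaleh a (scaleh b A) = scaleh (a * b) A.
Proof. by apply/val_inj; rewrite /= scalerA -rmorphM. Qed.
Fact scale1h : left_id 1 scaleh.
Proof. by move=> A; apply/val_inj; rewrite /= scale1r. Qed.
Fact scalehDr : right_distributive scaleh +%R.
Proof. by move=> a A B; apply/val_inj; rewrite /= scalerDr. Qed.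
Fact scalehDl A : {morph scaleh^~ A : a b / a + b}.
Proof. by move=> a b; apply/val_inj; rewrite /= rmorphD scalerDl. Qed.

HB.instance Definition _ := GRing.Zmodule_isLmodule.Build R (hermx R n)
  scalehA scale1h scalehDr scalehDl.

Definition herm_inner A B : R := complex.Re (\tr (A ^t* *m B)).

Definition herm_norm A : R := Num.sqrt (herm_inner A A).

Lemma herm_innerE A B :
  herm_inner A B = \sum_i \sum_j complex.Re ((A j i)^* * B j i).
Proof.
rewrite /herm_inner /mxtrace raddf_sum; apply: eq_bigr => i _.
by rewrite mxE raddf_sum; apply: eq_bigr => j _; rewrite !mxE.
Qed.

Lemma herm_innerC A B : herm_inner A B = herm_inner B A.
Proof.
rewrite !herm_innerE; apply: eq_bigr => i _; apply: eq_bigr => j _.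
by case: (A j i) (B j i) => [a b] [c d] /=; rewrite !mulNr mulrC (mulrC b).
Qed.

Lemma herm_innerDl A B C : 
  herm_inner (A + B) C = herm_inner A C + herm_inner B C.
Proof. by rewrite /herm_inner /= linearD /= map_mxD mulmxDl !raddfD. Qed.

Lemma herm_innerZl a A B : herm_inner (a *: A) B = a * herm_inner A B.
Proof.
rewrite !herm_innerE mulr_sumr; apply: eq_bigr => i _.
rewrite mulr_sumr; apply: eq_bigr => j _; rewrite !mxE.
by case: (A j i) (B j i) => [c d] [e f] /=; ring.
Qed.

Lemma herm_inner_ge0 A : 0 <= herm_inner A A.
Proof.
rewrite herm_innerE; do 2 apply: sumr_ge0 => ? _.
by case: (A _ _) => a b /=; rewrite mulNr opprK addr_ge0 // -expr2 sqr_ge0.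
Qed.

Lemma herm_inner_eq0 A : herm_inner A A = 0 -> A = 0.
Proof.
have ge0 (x : R[i]) : 0 <= complex.Re (x^* * x).
  by case: x => a b /=; rewrite mulNr opprK addr_ge0 // -expr2 sqr_ge0.
rewrite herm_innerE => A0; apply/val_inj/matrixP => j i; rewrite [RHS]mxE.
have /psumr_eq0P := A0 => /(_ (fun _ _ => sumr_ge0 _ (fun _ _ => ge0 _))).
move=> /(_ i isT) /psumr_eq0P => /(_ (fun _ _ => ge0 _) j isT) /=.
case: (A j i) => a b /= /eqP; rewrite mulNr opprK -!expr2.
by rewrite paddr_eq0 ?sqr_ge0// !sqrf_eq0 => /andP[/eqP-> /eqP->].
Qed.

Lemma herm_cauchy A B : herm_inner A B <= herm_norm A * herm_norm B.
Proof.
have [B0|B0] := eqVneq (herm_inner B B) 0.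
  rewrite (herm_inner_eq0 B0) herm_innerC -(scale0r 0) herm_innerZl mul0r.
  by rewrite mulr_ge0 ?sqrtr_ge0.
have Bgt0 : 0 < herm_inner B B by rewrite lt_neqAle eq_sym B0 herm_inner_ge0.
rewrite -sqrtrM ?herm_inner_ge0// (le_trans (ler_norm _))// -sqrtr_sqr.
rewrite ler_wsqrtr//.
have := herm_inner_ge0 (herm_inner B B *: A + (- herm_inner A B) *: B).
rewrite !(herm_innerDl, herm_innerZl) !(herm_innerC _ (_ + _)).
rewrite !(herm_innerDl, herm_innerZl) (herm_innerC B A).
set x := herm_inner A A; set y := herm_inner A B; set z := herm_inner B B.
rewrite (_ : _ + _ = z * (x * z - y ^+ 2)); last by ring.
by rewrite pmulr_rge0// subr_ge0.
Qed.

Lemma ler_herm_normD A B : herm_norm (A + B) <= herm_norm A + herm_norm B.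
Proof.
have nD : 0 <= herm_norm A + herm_norm B by rewrite addr_ge0 ?sqrtr_ge0.
rewrite -(ler_pXn2r (_ : 0 < 2)%N) ?nnegrE ?sqrtr_ge0//.
rewrite sqrrD !sqr_sqrtr ?herm_inner_ge0//.
rewrite herm_innerDl !(herm_innerC _ (A + B)) !herm_innerDl (herm_innerC B A).
rewrite addrA lerD2r -addrA lerD2l -mulr2n lerMn2r.
exact: herm_cauchy.
Qed.

Lemma herm_normZ a A : herm_norm (a *: A) = `|a| * herm_norm A.
Proof.
rewrite /herm_norm herm_innerZl herm_innerC herm_innerZl mulrA -expr2.
by rewrite sqrtrM ?sqr_ge0// sqrtr_sqr.
Qed.

Lemma herm_norm_eq0 A : herm_norm A = 0 -> A = 0.
Proof.
move=> /eqP; rewrite sqrtr_eq0 => A0; apply/herm_inner_eq0/eqP.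
by rewrite eq_le A0 herm_inner_ge0.
Qed.

HB.instance Definition _ := Lmodule_isNormed.Build R (hermx R n)
  ler_herm_normD herm_normZ herm_norm_eq0.


End hermx_lmodule.

(* The order on R[i] makes [0 <= z] mean that z is real and nonnegative. *)
Definition psd (R : realType) (n : nat) (A : hermx R n) : Prop :=
  forall v : 'cV[R[i]]_n, 0 <= (v ^t* *m A *m v) 0 0.

(* Square roots of the eigenvalues of A^* A, counted with multiplicity, in
   nonincreasing order. The list has n entries, so for n > m it is the usual
   list of min(m, n) singular values followed by n - m zeros. *)
Definition singular_values (R : realType) (m n : nat) (A : 'M[R[i]]_(m, n)) :
    seq R :=
  sort >=%O
    [seq Num.sqrt (complex.Re (spectral_diag (A ^t* *m A) 0 j)) | j : 'I_n].

Record mxspace (R : realType) := MxSpace {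
  ms_sort :> normedModType R ;
  inner : ms_sort -> ms_sort -> R ;
  mindim : nat ;
  mrank : ms_sort -> nat ;
  svals : ms_sort -> seq R }.

(* 'M[R]_(n1, n2) carries the library's max-norm; it is used for its topology
   only, all metric notions below being stated with [fro]. *)
Definition rect_space (R : realType) (n1 n2 : nat) : mxspace R :=
  @MxSpace R 'M[R]_(n1, n2)
    (fun A B => \tr (A^T *m B))
    (minn n1 n2)
    (fun A => \rank A)
    (fun A => singular_values (map_mx (real_complex R) A)).

Definition herm_space (R : realType) (n : nat) : mxspace R :=
  @MxSpace R (hermx R n)
    (@herm_inner R n)
    n
    (fun A => \rank (hermval A))
    (fun A => singular_values (hermval A)).

Section error_bound.
Variables (R : realType) (V : mxspace R).
Implicit Types (X Y Z : V) (A : set V) (f : V -> R) (df : V -> V).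

Definition fro X : R := Num.sqrt (inner X X).

(* The i-th singular value, i >= 1. *)
Definition sigma X (i : nat) : R := nth 0 (svals X) i.-1.

Definition tail_sum (kappa : nat) X : R :=
  \sum_(kappa.+1 <= i < (mindim V).+1) sigma X i.

Definition fro_dist X A : R := inf [set fro (X - Y) | Y in A].

Definition is_proj A X Z : Prop :=
  A Z /\ forall Y, A Y -> fro (X - Z) <= fro (X - Y).

Definition calm_at (W : normedModType R) (G : W -> set V) (w0 : W) X : Prop :=
  exists2 alpha : R, 0 <= alpha &
  exists (P : set W) (Q : set V), [/\ nbhs w0 P, nbhs X Q &
    forall w, P w -> G w `&` Q `<=`
      [set Y + (alpha * `|w - w0|) *: B | Y in G w0 & B in [set B | fro B <= 1]]].

Definition feasible (kappa : nat) (Omega : set V) : set V :=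
  [set X | Omega X /\ (mrank X <= kappa)%N].

Definition Gamma (kappa : nat) (Omega : set V) (w : R) : set V :=
  [set X | Omega X /\ tail_sum kappa X = w].

Definition minimizers f A : set V :=
  [set Y | A Y /\ forall X, A X -> f Y <= f X].

(* f is continuously differentiable and df is its gradient for [inner]. *)
Definition smooth_with_gradient f df : Prop :=
  (forall X, differentiable f X /\ forall H, 'd f X H = inner (df X) H) /\
  continuous df.

(* Extended-real valued: it is +oo when no admissible pair (X, Y) exists. *)
Definition growth_modulus f df A : \bar R :=
  ereal_inf [set t | exists X Y, [/\ A X, minimizers f A Y, X <> Y &
    t = ((f X - f Y - inner (df Y) (X - Y)) / fro (X - Y) ^+ 2)%:E]].

Definition error_bound f df (kappa : nat) (Omega : set V) (c : R) : Prop :=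
  let F := feasible kappa Omega in
  let Fstar := minimizers f F in
  forall X Z Y, Omega X -> is_proj F X Z -> Fstar Y ->
    ((fro_dist X Fstar)%:E <= (c * tail_sum kappa X)%:E +
       (growth_modulus f df F)^-1 * (fro (df Z - df Y))%:E)%E.

End error_bound.

Definition is_norm (R : realType) (n1 n2 : nat) (N : 'M[R]_(n1, n2) -> R) : Prop :=
  [/\ forall A B, N (A + B) <= N A + N B,
      forall (a : R) A, N (a *: A) = `|a| * N A &
      forall A, N A = 0 -> A = 0].

(* Main.v *)
(** Let Z be the projection of X onto F and Y a minimizer.  The growth condition
    at Y and the gradient inequality at Z give
    theta |Z - Y|^2 <= <df Z - df Y, Z - Y>, hence
    |Z - Y| <= theta^-1 |df Z - df Y| by Cauchy-Schwarz.  It remains to bound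
    |X - Z| = dist(X, F) by c times the tail t(X), and for this it suffices to
    exhibit one point of F that close to X.

    In general, truncating the singular value decomposition gives
    t(X) >= dist(X, {rank <= kappa}); as a matrix of rank > kappa stays at a
    positive distance from those of rank <= kappa, t is bounded below near each
    point of Omega \ F, calmness handles the points of F, and compactness of
    Omega makes the constant uniform.  In (i) the truncation of X is rescaled
    into the ball; in (ii) the mass of the discarded eigenvalues is moved to a
    retained one; in (iii) the truncation A is replaced by S A S with S the
    diagonal matrix of the (A i i)^(-1/2), unless some A i i vanishes, in which
    case t(X) >= 1 and any point of F will do. *)

Require Import Defs.
From HB Require Import structures.
From mathcomp Require Import all_boot all_order all_algebra sesquilinear spectral.
From mathcomp Require Import complex.
From mathcomp Require Import all_classical all_reals all_analysis.
From mathcomp Require Import ring lra.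
Set Implicit Arguments.
Unset Strict Implicit.
Unset Printing Implicit Defensive.
Import Order.TTheory GRing.Theory Num.Theory.
Import numFieldNormedType.Exports.
Local Open Scope ring_scope.
Local Open Scope sesquilinear_scope.
Local Open Scope complex_scope.

(** * Characteristic polynomials under conjugation, and a rank bound *)

Lemma char_poly_conj (F : comNzRingType) n (P Q D : 'M[F]_n) :
  Q *m P = 1%:M -> P *m Q = 1%:M -> char_poly (P *m D *m Q) = char_poly D.
Proof.
move=> QP PQ; rewrite /char_poly.
have -> : char_poly_mx (P *m D *m Q) =
    map_mx polyC P *m char_poly_mx D *m map_mx polyC Q.
  rewrite /char_poly_mx mulmxBr mulmxBl !map_mxM; congr (_ - _).
  by rewrite mul_mx_scalar -scalemxAl -map_mxM PQ map_mx1 scalemx1.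
by rewrite !det_mulmx mulrC mulrA -det_mulmx -map_mxM QP map_mx1 det1 mul1r.
Qed.

Lemma rank_diag_mx_le (F : fieldType) n (d : 'rV[F]_n) (S : {set 'I_n}) :
  (forall j, j \notin S -> d 0 j = 0) -> (\rank (diag_mx d) <= #|S|)%N.
Proof.
move=> dS; rewrite diag_mx_sum_delta (bigID (mem S)) /= [X in _ + X]big1 ?addr0.
  rewrite -sum1_card.
  apply: (big_ind2 (fun (A : 'M[F]_n) k => \rank A <= k)%N).
  - by rewrite mxrank0.
  - by move=> A k B l Ak Bl; rewrite (leq_trans (mxrank_add _ _)) ?leq_add.
  - by move=> i _; rewrite (leq_trans (mxrank_scale _ _)) ?mxrank_delta.
by move=> i /dS ->; rewrite scale0r.
Qed.

(** * Real symmetric matrices *)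

Section RealSpectral.
Variable R : realType.

(** Over [R[i]] an eigenvalue [c] with eigenvector [v] exists. Since [M] is Hermitian,
    [v M v^* = c |v|^2] is real with [|v|^2 > 0], so [c] is real and hence already an eigenvalue of
    [A]. *)
Lemma symmetric_eigenvalue n (A : 'M[R]_n.+1) : A^T = A ->
  exists a, eigenvalue A a.
Proof.
move=> symA; pose M := map_mx (real_complex R) A.
have [c ev] := @eigenvalue_closed R[i] _ M isT.
have hM : M ^t* = M.
  rewrite /M -[in RHS]symA; apply/matrixP=> i j; rewrite !mxE.
  by apply/CrealP; rewrite complex_real.
have /eigenvalueP[v vM v0] := ev.
have vv : 0 < (v *m v ^t*) 0 0 by rewrite -dotmxE dnorm_gt0.
have vMv : ((v *m M *m v ^t*) 0 0)^* = (v *m M *m v ^t*) 0 0.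
  have : (v *m M *m v ^t*) ^t* = v *m M *m v ^t*.
    by rewrite !trmx_mul !map_mxM /= trmxCK hM mulmxA.
  by move/matrixP => /(_ 0 0); rewrite !mxE.
have creal : c \is Num.real.
  rewrite CrealE; move: vMv; rewrite vM -scalemxAl !mxE rmorphM /=.
  have := vv; rewrite !mxE; set x := \sum_(_ < _) _ => x0 /eqP.
  rewrite (CrealP (gtr0_real x0) : x^*%C = x).
  by rewrite (inj_eq (mulIf _)) // gt_eqF.
exists (complex.Re c); rewrite -(eigenvalue_map (real_complex R)).
by rewrite /= RRe_real.
Qed.

(* The Householder reflection in the hyperplane orthogonal to [u - e_0]. *)
Lemma orthogonal_with_row0 n (u : 'rV[R]_n.+1) : u *m u^T = 1%:M ->
  exists H : 'M[R]_n.+1, [/\ H^T = H, H *m H = 1%:M & delta_mx 0 0 *m H = u].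
Proof.
move=> uu; pose e : 'rV[R]_n.+1 := delta_mx 0 0; pose w := u - e.
have ee : e *m e^T = 1%:M.
  rewrite trmx_delta mul_delta_mx [RHS]mx11_scalar.
  by apply/matrixP=> i j; rewrite !ord1 !mxE.
have scE (A : 'M[R]_1) : A = (A 0 0)%:M by rewrite [LHS]mx11_scalar.
have ueT : u *m e^T = (u 0 0)%:M.
  by rewrite [LHS]scE; congr (_%:M); rewrite trmx_delta -colE mxE.
have euT : e *m u^T = (u 0 0)%:M by rewrite -[RHS]tr_scalar_mx -ueT trmx_mul trmxK.
have ww : w *m w^T = (2 - 2 * u 0 0)%:M.
  rewrite linearB /= mulmxBl !mulmxBr uu ee ueT euT.
  by rewrite -!raddfB /=; congr (_%:M); ring.
have ew : e *m w^T = (u 0 0 - 1)%:M.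
  by rewrite linearB /= mulmxBr ee euT -raddfB.
have [u1|u1] := eqVneq (u 0 0) 1.
  (* Here [w] has length zero, so [u] equals [e] and the identity serves. *)
  exists 1%:M; rewrite trmx1 mulmx1; split=> //.
  apply/eqP; rewrite mulmx1 eq_sym -subr_eq0; apply/eqP.
  have := ww; rewrite u1 mulr1 subrr => /matrixP /(_ 0 0); rewrite !mxE eqxx.
  under eq_bigr do rewrite [w^T _ _]mxE -expr2.
  move/psumr_eq0P => w0; apply/matrixP=> i j; rewrite ord1.
  have /eqP := w0 (fun _ _ => sqr_ge0 _) j isT.
  by rewrite sqrf_eq0 [in RHS]mxE => /eqP.
(* As [k = 2 / |w|^2], the matrix [1 - k w^T w] is the reflection exchanging [e] and [u]. *)
pose k := 2 / (2 - 2 * u 0 0).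
have k0 : 2 - 2 * u 0 0 != 0.
  by apply: contra u1 => /eqP h; apply/eqP; lra.
have WW : (w^T *m w) *m (w^T *m w) = (2 - 2 * u 0 0) *: (w^T *m w).
  by rewrite mulmxA -[w^T *m w *m w^T]mulmxA ww mul_mx_scalar -scalemxAl.
have eW : e *m (w^T *m w) = (u 0 0 - 1) *: w.
  by rewrite mulmxA ew mul_scalar_mx.
have WT : (w^T *m w)^T = w^T *m w by rewrite trmx_mul trmxK.
move: (w^T *m w) WW eW WT => W WW eW WT.
exists (1%:M - k *: W); split.
- by rewrite linearB /= linearZ /= WT trmx1.
- rewrite mulmxBl mul1mx mulmxBr mulmx1 -!scalemxAl -!scalemxAr WW !scalerA.
  rewrite -addrA -[RHS]addr0; congr (_ + _).
  rewrite -[X in X + _]scaleNr -scalerBl -scalerBl.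
  by rewrite (_ : _ - _ = 0) ?scale0r // /k; field.
- rewrite mulmxBr mulmx1 -scalemxAr eW scalerA.
  rewrite (_ : k * _ = -1); last by rewrite /k; field.
  by rewrite scaleN1r opprK addrC subrK.
Qed.

(* The library's spectral theorem is over a closed field; truncating a real
   matrix needs a real orthogonal basis. *)
Lemma symmetric_spectral n (A : 'M[R]_n) : A^T = A ->
  exists (P : 'M[R]_n) (d : 'rV[R]_n),
    P *m P^T = 1%:M /\ A = P^T *m diag_mx d *m P.
Proof.
elim: n => [|n IHn] in A *.
  by exists 0, 0; split; apply/matrixP => -[].
move=> symA; have [a /eigenvalueP[v vA v0]] := symmetric_eigenvalue symA.
pose s := (v *m v^T) 0 0.
have s0 : 0 < s.
  rewrite lt0r; apply/andP; split; last first.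
    by rewrite /s mxE sumr_ge0 // => i _; rewrite mxE -expr2 sqr_ge0.
  apply: contra v0; rewrite /s mxE psumr_eq0; last first.
    by move=> i _; rewrite mxE -expr2 sqr_ge0.
  move/allP => vi0; apply/eqP/matrixP=> i j; rewrite ord1 [RHS]mxE.
  have := vi0 j (mem_index_enum _); rewrite mxE -expr2 sqrf_eq0.
  by move/eqP.
pose u := (Num.sqrt s)^-1 *: v.
have uA : u *m A = a *: u by rewrite -scalemxAl vA !scalerA mulrC.
have uu : u *m u^T = 1%:M.
  rewrite linearZ /= -scalemxAl -scalemxAr scalerA [v *m _]mx11_scalar -/s.
  rewrite scale_scalar_mx -expr2 exprVn sqr_sqrtr ?ltW // mulVf ?gt_eqF //.
have [H [HT HH eH]] := orthogonal_with_row0 uu.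
(* The first row of [H] is the unit eigenvector [u], so the first row of [B] is [a e_0]. By symmetry
   [B] is block diagonal, and induction applies to its lower right block. *)
pose B : 'M[R]_(1 + n) := H *m A *m H.
have BT : B^T = B by rewrite /B !trmx_mul symA HT mulmxA.
have eB : (delta_mx 0 0 : 'rV_(1 + n)) *m B = a *: delta_mx 0 0.
  by rewrite /B !mulmxA eH uA -scalemxAl -eH -mulmxA HH mulmx1.
have BrS : ursubmx B = 0.
  apply/matrixP=> i j; rewrite !mxE.
  have /matrixP /(_ 0 (rshift 1 j)) := eB.
  by rewrite -rowE !mxE ord1 lshift0 /= mulr0.
have Bul : ulsubmx B = a%:M.
  apply/matrixP=> i j; rewrite !mxE.
  have /matrixP /(_ 0 (lshift n j)) := eB.
  by rewrite -rowE !mxE !ord1 lshift0 /= mulr1.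
have Bdl : dlsubmx B = 0 by rewrite -{1}BT -trmx_ursub BrS trmx0.
have symC : (drsubmx B)^T = drsubmx B by rewrite trmx_drsub BT.
have [P [d [PP Pd]]] := IHn _ symC.
pose Q : 'M[R]_(1 + n) := block_mx 1%:M 0 0 P.
have QT : Q^T = block_mx 1%:M 0 0 P^T by rewrite tr_block_mx !trmx0 trmx1.
have QQ : Q *m Q^T = 1%:M.
  rewrite QT mulmx_block !mulmx0 !mul0mx !addr0 !add0r PP mulmx1.
  by rewrite -scalar_mx_block.
have BE : B = Q^T *m diag_mx (row_mx a%:M d) *m Q.
  rewrite QT diag_mx_row !mulmx_block !(mulmx0, mul0mx, addr0, add0r, mul1mx, mulmx1).
  rewrite -Pd -[LHS]submxK Bul BrS Bdl; congr block_mx.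
  by apply/matrixP=> i j; rewrite !ord1 !mxE.
exists (Q *m H), (row_mx a%:M d : 'rV_(1 + n)); split.
  by rewrite trmx_mul HT mulmxA -[Q *m H *m H]mulmxA HH mulmx1.
transitivity (H *m B *m H); last by rewrite BE trmx_mul HT !mulmxA.
by rewrite /B !mulmxA HH mul1mx -mulmxA HH mulmx1.
Qed.
End RealSpectral.

(** * Ranks of diagonal matrices and tails of sorted lists *)

(** For the lower bound, the indicator of [S] factors through [diag_mx d], while the indicators of
    [S] and of its complement add up to the identity, of rank [n]. *)
Lemma rank_diag_mx (F : fieldType) n (d : 'rV[F]_n) :
  \rank (diag_mx d) = #|[set j | d 0 j != 0]|.
Proof.
set S := [set j | _]; apply/eqP; rewrite eqn_leq; apply/andP; split.
  by apply: rank_diag_mx_le => j; rewrite inE negbK => /eqP.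
pose e (T : {set 'I_n}) : 'rV[F]_n := \row_j (j \in T)%:R.
have eS : diag_mx (e S) = diag_mx d *m diag_mx (\row_j (d 0 j)^-1).
  rewrite mulmx_diag; congr diag_mx; apply/rowP => j; rewrite !mxE inE.
  by have [->|d0] := eqVneq (d 0 j) 0; rewrite ?mul0r ?mulfV.
have e1 : 1%:M = diag_mx (e S) + diag_mx (e (~: S)).
  rewrite -linearD /= -diag_const_mx; congr diag_mx; apply/rowP => j.
  by rewrite !mxE finset.in_setC; case: (j \in S); rewrite ?addr0 ?add0r.
have rS : (\rank (diag_mx (e S)) <= \rank (diag_mx d))%N.
  by rewrite eS mxrankM_maxl.
have rC : (\rank (diag_mx (e (~: S))) <= #|~: S|)%N.
  by apply: rank_diag_mx_le => j /negbTE jS; rewrite mxE jS.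
rewrite -(leq_add2r #|~: S|) cardsC card_ord -[X in (X <= _)%N](mxrank1 F) e1.
exact: leq_trans (mxrank_add _ _) (leq_add rS rC).
Qed.

Lemma sum_nth_drop (R : nmodType) (s : seq R) k :
  \sum_(k <= i < size s) nth 0 s i = \sum_(x <- drop k s) x.
Proof.
rewrite [RHS](big_nth 0) size_drop -{1}[k]add0n big_addn.
by apply: eq_bigr => i _; rewrite nth_drop addnC.
Qed.

(** Sorting the indices by [f], rather than the values, yields a genuine index set [S] for the [k]
    largest values even when values tie. Truncations keep exactly the eigenvalues indexed by [S]. *)
Lemma sum_sort_tail (R : realDomainType) n (f : 'I_n -> R) k :
  exists S : {set 'I_n}, #|S| = minn k n /\
    \sum_(k <= i < n) nth 0 (sort >=%O [seq f j | j : 'I_n]) i =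
    \sum_(j | j \notin S) f j.
Proof.
pose I := sort (relpre f >=%O) (enum 'I_n).
have I_perm : perm_eq I (enum 'I_n) by rewrite perm_sort.
have uI : uniq I by rewrite sort_uniq enum_uniq.
have sI : size I = n by rewrite size_sort size_enum_ord.
have -> : sort >=%O [seq f j | j : 'I_n] = map f I by rewrite sort_map.
pose S := [set j in take k I]; have inS j : (j \in S) = (j \in take k I).
  by rewrite inE.
exists S; split.
  by rewrite cardsE (card_uniqP (take_uniq k uI)) size_take sI /minn.
rewrite -[X in \sum_(k <= i < X) _]sI -(size_map f) sum_nth_drop.
rewrite -map_drop big_map [RHS](perm_big I) /=; last first.
  by rewrite perm_sym (perm_trans I_perm) // enumT.
rewrite -[in RHS](cat_take_drop k I) big_cat /= [X in X + _]big1_seq ?add0r.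
  rewrite [RHS]big_seq_cond [LHS]big_seq; apply: eq_bigl => j.
  rewrite [RHS]/= inS; case jd : (j \in drop k I) => //=.
  move: uI; rewrite -{1}(cat_take_drop k I) cat_uniq => /and3P[_ /hasPn h _].
  by rewrite (h _ jd).
by move=> j; rewrite inS => /andP[/negbTE ->].
Qed.

(** * Unitary diagonalization and singular values *)

Section ComplexUnitaryDiagonal.
Variable C : numClosedFieldType.

(** For unitary [U], this is the normal matrix with eigenvalues [l] whose eigenvectors are the
    columns of [U ^t*]. *)
Definition cdiag n (U : 'M[C]_n) (l : 'rV[C]_n) : 'M[C]_n :=
  U ^t* *m diag_mx l *m U.

Lemma unitarymxCl n (U : 'M[C]_n) : U \is unitarymx -> U ^t* *m U = 1%:M.
Proof.
by move=> hU; rewrite -(invmx_unitary hU) mulVmx ?unitarymx_unit.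
Qed.

Lemma cdiag_adj n (U : 'M[C]_n) l : l \is a realmx -> (cdiag U l) ^t* = cdiag U l.
Proof.
move=> lr; rewrite /cdiag !trmx_mul !map_mxM /= trmxCK mulmxA.
by rewrite tr_diag_mx map_diag_mx (realmxC lr).
Qed.

Lemma hermitian_cdiag n (M : 'M[C]_n) : M \is hermsymmx ->
  M = cdiag (spectralmx M) (spectral_diag M).
Proof.
move=> /hermitian_normalmx /orthomx_spectralP {1}->.
by rewrite invmx_unitary ?spectral_unitarymx.
Qed.

Lemma cdiagB n (U : 'M[C]_n) l k : cdiag U (l - k) = cdiag U l - cdiag U k.
Proof. by rewrite /cdiag linearB /= mulmxBr mulmxBl. Qed.

Lemma cdiagM n (U : 'M[C]_n) l k : U \is unitarymx ->
  cdiag U l *m cdiag U k = cdiag U (\row_j (l 0 j * k 0 j)).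
Proof.
move=> /unitarymxP hU; rewrite /cdiag !mulmxA -[_ *m U *m U ^t*]mulmxA hU mulmx1.
by rewrite -[_ *m diag_mx _ *m diag_mx _]mulmxA mulmx_diag.
Qed.

Lemma cdiagE n (U : 'M[C]_n) l i j :
  cdiag U l i j = \sum_k l 0 k * ((U k i)^* * U k j).
Proof.
rewrite /cdiag mxE; apply: eq_bigr => k _.
by rewrite mul_mx_diag !mxE mulrA [X in X * _]mulrC.
Qed.

Lemma cdiag_quad n (U : 'M[C]_n) l (v : 'cV[C]_n) :
  (v ^t* *m cdiag U l *m v) 0 0 = \sum_k l 0 k * `|(U *m v) k 0| ^+ 2.
Proof.
have [w ew] : exists w, w = U *m v by exists (U *m v).
rewrite -ew.
have -> : v ^t* *m cdiag U l *m v = w ^t* *m diag_mx l *m w.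
  by rewrite ew trmx_mul map_mxM /cdiag !mulmxA.
rewrite mxE; apply: eq_bigr => k _; rewrite mul_mx_diag mxE normCK.
by rewrite 2!mxE mulrAC mulrC [X in _ * X = _]mulrC.
Qed.

Lemma mxtrace_cdiag n (U : 'M[C]_n) l : U \is unitarymx ->
  \tr (cdiag U l) = \sum_k l 0 k.
Proof.
by move=> /unitarymxP hU; rewrite mxtrace_mulC mulmxA hU mul1mx mxtrace_diag.
Qed.

Lemma rank_cdiag n (U : 'M[C]_n) l : U \is unitarymx ->
  \rank (cdiag U l) = #|[set j | l 0 j != 0]|.
Proof.
move=> hU; rewrite /cdiag mxrankMfree ?row_free_unit ?unitarymx_unit //.
rewrite -mxrank_tr trmx_mul mxrankMfree; last first.
  by rewrite row_free_unit unitmx_tr unitarymx_unit ?trmxC_unitary.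
by rewrite mxrank_tr rank_diag_mx.
Qed.

Lemma char_poly_cdiag n (U : 'M[C]_n) l : U \is unitarymx ->
  char_poly (cdiag U l) = \prod_(x <- [seq l 0 j | j : 'I_n]) ('X - x%:P).
Proof.
move=> hU; rewrite char_poly_conj ?unitarymxCl //; last exact/unitarymxP.
rewrite char_poly_trig ?diag_mx_is_trig // big_image /=.
by apply: eq_bigr => j _; rewrite !mxE eqxx.
Qed.

(** Both lists are the roots, with multiplicity, of one characteristic polynomial. Singular values
    can thus be read off any unitary diagonalization, not only the one behind [spectral_diag]. *)
Lemma cdiag_perm_eq n (U V : 'M[C]_n) l k : U \is unitarymx -> V \is unitarymx ->
  cdiag U l = cdiag V k -> perm_eq [seq l 0 j | j : 'I_n] [seq k 0 j | j : 'I_n].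
Proof.
move=> hU hV e; apply: prod_XsubC_eq.
by rewrite -(char_poly_cdiag _ hU) e char_poly_cdiag.
Qed.

Lemma gram_hermsym m n (A : 'M[C]_(m, n)) : A ^t* *m A \is hermsymmx.
Proof.
by apply/is_hermitianmxP; rewrite expr0 scale1r trmx_mul map_mxM /= trmxCK.
Qed.

Lemma sandwich_adj n (D M : 'M[C]_n) : D ^t* = D -> M ^t* = M ->
  (D *m M *m D) ^t* = D *m M *m D.
Proof. by move=> DT MT; rewrite !trmx_mul !map_mxM /= DT MT mulmxA. Qed.

Lemma sandwich_quad n (D M : 'M[C]_n) (v : 'cV[C]_n) : D ^t* = D ->
  v ^t* *m (D *m M *m D) *m v = (D *m v) ^t* *m M *m (D *m v).
Proof. by move=> DT; rewrite trmx_mul map_mxM /= DT !mulmxA. Qed.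

End ComplexUnitaryDiagonal.

Section UnitaryDiagonal.
Variable R : realType.
Local Notation C := R[i].

(** The squared modulus as an element of [R]; the norm on [R[i]] takes its values in [R[i]]. *)
Definition sqnormc (z : C) : R := complex.Re z ^+ 2 + complex.Im z ^+ 2.

Lemma sqnormc_ge0 z : 0 <= sqnormc z.
Proof. by rewrite addr_ge0 ?sqr_ge0. Qed.

Lemma sqnormcZ (a : R) z : sqnormc (a%:C * z) = a ^+ 2 * sqnormc z.
Proof. by case: z => x y; rewrite /sqnormc /=; ring. Qed.

Definition udiag n (U : 'M[C]_n) (l : 'rV[R]_n) : 'M[C]_n :=
  cdiag U (\row_j (l 0 j)%:C).

Lemma hermsym_udiag n (M : 'M[C]_n) : M \is hermsymmx ->
  M = udiag (spectralmx M) (\row_j complex.Re (spectral_diag M 0 j)).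
Proof.
move=> hM; rewrite [LHS](hermitian_cdiag hM); congr cdiag.
apply/rowP => j; rewrite !mxE RRe_real //.
exact: (mxOverP (hermitian_spectral_diag_real hM)).
Qed.

Lemma udiag_hermsym n (U : 'M[C]_n) l : udiag U l \is hermsymmx.
Proof.
rewrite hermsymE /udiag cdiag_adj //.
by apply/mxOverP => i j; rewrite mxE complex_real.
Qed.

Lemma udiagB n (U : 'M[C]_n) l k : udiag U (l - k) = udiag U l - udiag U k.
Proof.
by rewrite -cdiagB; congr cdiag; apply/rowP => j; rewrite !mxE rmorphB.
Qed.

Lemma udiagM n (U : 'M[C]_n) l k : U \is unitarymx ->
  udiag U l *m udiag U k = udiag U (\row_j (l 0 j * k 0 j)).
Proof.
move=> hU; apply: etrans (cdiagM _ _ hU) _.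
congr cdiag.
by apply/rowP => j; rewrite !mxE rmorphM.
Qed.

Lemma udiag_diagE n (U : 'M[C]_n) l i :
  udiag U l i i = (\sum_k l 0 k * sqnormc (U k i))%:C.
Proof.
rewrite /udiag cdiagE rmorph_sum /=; apply: eq_bigr => k _.
by rewrite mxE rmorphM /= add_Re2_Im2 sqr_normc [X in _ = _ * X]mulrC.
Qed.

Lemma udiag_quad n (U : 'M[C]_n) l (v : 'cV[C]_n) :
  (v ^t* *m udiag U l *m v) 0 0 =
  (\sum_k l 0 k * sqnormc ((U *m v) k 0))%:C.
Proof.
rewrite /udiag cdiag_quad rmorph_sum /=; apply: eq_bigr => k _.
by rewrite mxE rmorphM /= add_Re2_Im2.
Qed.

Lemma mxtrace_udiag n (U : 'M[C]_n) l : U \is unitarymx ->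
  \tr (udiag U l) = (\sum_k l 0 k)%:C.
Proof.
move=> hU; rewrite /udiag mxtrace_cdiag // rmorph_sum /=.
by apply: eq_bigr => k _; rewrite mxE.
Qed.

Lemma rank_udiag n (U : 'M[C]_n) l : U \is unitarymx ->
  \rank (udiag U l) = #|[set j | l 0 j != 0]|.
Proof.
move=> hU; rewrite /udiag rank_cdiag //; apply: eq_card => j.
by rewrite !inE mxE eq_complex /= eqxx andbT.
Qed.

(** Two diagonalizations of [A^* A] list the same eigenvalues up to order, and sorting erases the
    order. *)
Lemma singular_values_udiag m n (A : 'M[C]_(m, n)) (U : 'M[C]_n) l :
  U \is unitarymx -> A ^t* *m A = udiag U l ->
  singular_values A = sort >=%O [seq Num.sqrt (l 0 j) | j : 'I_n].
Proof.
move=> hU eA; set M := A ^t* *m A in eA *.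
have hM : M \is hermsymmx by exact: gram_hermsym.
have := cdiag_perm_eq (spectral_unitarymx M) hU.
move=> /(_ _ _ (etrans (esym (hermitian_cdiag hM)) eA)).
move/(perm_map (fun z : C => Num.sqrt (complex.Re z))).
rewrite -[X in perm_eq X _]map_comp -[X in perm_eq _ X]map_comp => p.
rewrite /singular_values; apply/perm_sortP => //.
- by move=> x y; exact: le_total.
- by move=> x y z /[swap]; exact: le_trans.
- by move=> x y; rewrite andbC; exact: le_anti.
rewrite (perm_trans p) //; set s := [seq _ | j : 'I_n].
rewrite [X in perm_eq X s](_ : _ = s) //.
by apply: eq_map => j /=; rewrite mxE.
Qed.

Lemma nth_singular_values_ge0 m n (A : 'M[C]_(m, n)) i :
  0 <= nth 0 (singular_values A) i.
Proof.
have [h|h] := ltnP i (size (singular_values A)); last by rewrite nth_default.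
have : all (>= 0) (singular_values A).
  by rewrite all_sort all_map; apply/allP => j _ /=; exact: sqrtr_ge0.
by move/all_nthP => /(_ 0 i h).
Qed.

(** If entry [i] were positive, the nonincreasing list would start with [i + 1] positive entries,
    giving [A^* A] more than [i] nonzero eigenvalues although its rank is at most that of [A]. *)
Lemma nth_singular_values_ge_rank m n (A : 'M[C]_(m, n)) i :
  (\rank A <= i)%N -> nth 0 (singular_values A) i = 0.
Proof.
move=> rAi; apply/eqP; case: ltgtP (nth_singular_values_ge0 A i) => // si _.
have hU := spectral_unitarymx (A ^t* *m A).
have eM := hermsym_udiag (gram_hermsym A).
set l := \row_j _ in eM.
have rM : (\rank (A ^t* *m A) <= i)%N by apply: leq_trans rAi; exact: mxrankM_maxr.
rewrite eM rank_udiag // in rM.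
have sE := singular_values_udiag hU eM.
set s := singular_values A in sE si.
have ssort : sorted >=%O s.
  by rewrite sE; apply: sort_sorted => x y; exact: le_total.
have si_lt : (i < size s)%N.
  by rewrite ltnNge; apply/negP => h; rewrite nth_default ?ltxx in si.
pose pos := [pred x : R | 0 < x].
have : (i < count pos s)%N.
  rewrite -(cat_take_drop i.+1 s) count_cat.
  have /all_filterP : all pos (take i.+1 s).
    apply/(all_nthP 0) => j; rewrite size_takel // ltnS => ji.
    rewrite nth_take //= (lt_le_trans si) //.
    apply: (sorted_leq_nth _ _ 0 ssort) => //; last by rewrite inE (leq_ltn_trans ji).
      by move=> x y z h1 h2; exact: le_trans h2 h1.
    by move=> x; exact: lexx.
  by rewrite -[count pos (take _ _)]size_filter => ->; rewrite size_takel // ltn_addr.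
rewrite sE count_sort count_map -sum1_count big_enum_cond /= sum1dep_card => ic.
suff : (i < i)%N by rewrite ltnn.
apply: (leq_trans ic); apply: leq_trans rM; apply: subset_leq_card.
apply/fintype.subsetP => x; rewrite !inE sqrtr_gt0 => l0; exact: lt0r_neq0.
Qed.

End UnitaryDiagonal.

(** * Separation of a matrix from those of smaller rank *)

(* With L X P = 1, a nonzero u killed by L Y P satisfies u = u (L (X - Y) P), and
   the entrywise l1 norm is submultiplicative. *)
Lemma rank_gap (F : numFieldType) m n (X : 'M[F]_(m, n)) k :
  (k < \rank X)%N -> exists2 e : F, 0 < e &
    forall Y : 'M[F]_(m, n), (\rank Y <= k)%N -> e <= \sum_i \sum_j `|(X - Y) i j|.
Proof.
move=> kr.
pose N p q (A : 'M[F]_(p, q)) := \sum_i \sum_j `|A i j|.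
have N0 p q (A : 'M[F]_(p, q)) : 0 <= N _ _ A by do 2 apply: sumr_ge0 => ? _.
have NM p q r (A : 'M[F]_(p, q)) (B : 'M[F]_(q, r)) :
    N _ _ (A *m B) <= N _ _ A * N _ _ B.
  rewrite /N mulr_suml; apply: ler_sum => i _.
  have : \sum_j `|(A *m B) i j| <= \sum_k `|A i k| * \sum_j `|B k j|.
    under [leRHS]eq_bigr do rewrite mulr_sumr.
    rewrite exchange_big /=; apply: ler_sum => j _; rewrite mxE.
    by apply: (le_trans (ler_norm_sum _ _ _)); apply: ler_sum => l _; rewrite normrM.
  move/le_trans; apply; rewrite mulr_suml; apply: ler_sum => l _.
  rewrite ler_wpM2l // (bigD1 l) //= lerDl.
  by apply: sumr_ge0 => *; apply: sumr_ge0.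
(* Gaussian elimination writes [X] as [col_ebase X *m pid_mx (\rank X) *m row_ebase X]; [L] and [P]
   undo the outer factors and cut out the identity block. *)
pose L : 'M[F]_(\rank X, m) := pid_mx (\rank X) *m invmx (col_ebase X).
pose P : 'M[F]_(n, \rank X) := invmx (row_ebase X) *m pid_mx (\rank X).
have LXP : L *m X *m P = 1%:M.
  rewrite -[X in _ *m X *m P]mulmx_ebase /L /P !mulmxA.
  rewrite mulmxKV ?col_ebase_unit // -!mulmxA mulKVmx ?row_ebase_unit //.
  by rewrite !mul_pid_mx !minnn !(minn_idPr _) ?rank_leq_col ?rank_leq_row // pid_mx_1.
have main (Y : 'M[F]_(m, n)) : (\rank Y <= k)%N ->
    1 <= N _ _ L * N _ _ (X - Y) * N _ _ P.
  (* The square matrix [L Y P] has size [\rank X > k] and rank at most [k], so it is singular. *)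
  move=> rY; have : kermx (L *m Y *m P) != 0.
    rewrite kermx_eq0; apply/negP => /eqP rf.
    have : (\rank X <= k)%N; last by rewrite leqNgt kr.
    rewrite -rf (leq_trans (mxrankM_maxl _ _)) // (leq_trans (mxrankM_maxr _ _)) //.
  move=> /rowV0Pn[u /sub_kermxP uK u0].
  have eu : u = u *m (L *m (X - Y) *m P).
    by rewrite mulmxBr mulmxBl mulmxBr uK subr0 LXP mulmx1.
  have Nu : 0 < N _ _ u.
    rewrite lt0r N0 andbT; apply: contra u0.
    rewrite /N big_ord1 psumr_eq0 // => /allP h; apply/eqP/rowP => j.
    by have := h j (mem_index_enum _); rewrite normr_eq0 mxE => /eqP.
  rewrite -(ler_pM2l Nu) mulr1 {1}eu; apply: (le_trans (NM _ _ _ _ _)).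
  rewrite ler_wpM2l // (le_trans (NM _ _ _ _ _)) // ler_wpM2r //.
(* The summand 1 makes the denominator positive even if the product vanishes. *)
exists (1 + N _ _ L * N _ _ P)^-1.
  by rewrite invr_gt0 ltr_pwDl // mulr_ge0.
move=> Y /main; rewrite -/(N _ _ (X - Y)) => h.
have c0 : 0 < 1 + N _ _ L * N _ _ P by rewrite ltr_pwDl // mulr_ge0.
rewrite -[(_)^-1]mul1r ler_pdivrMr // mulrDr mulr1 (le_trans h) //.
by rewrite mulrAC mulrC lerDr.
Qed.

(** Dropping nonnegative cross terms bounds the l2 norm by the l1 norm. This is how the Frobenius
    norm of a discarded part is bounded by a sum of singular values. *)
Lemma sum_sqr_le (R : realDomainType) (I : Type) (r : seq I) (P : pred I) (a : I -> R) :
  (forall i, P i -> 0 <= a i) ->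
  \sum_(i <- r | P i) a i ^+ 2 <= (\sum_(i <- r | P i) a i) ^+ 2.
Proof.
move=> a0; elim: r => [|i r IH]; first by rewrite !big_nil expr0n.
rewrite !big_cons; case: ifP => Pi //; rewrite sqrrD -addrA lerD2l.
rewrite (le_trans IH) // lerDr mulrn_wge0 // mulr_ge0 ?a0 //.
by apply: sumr_ge0.
Qed.

(** * Truncation and low-rank approximation *)

Section Truncation.
Variable R : realType.
Local Notation C := R[i].

(** The list [singular_values A] has [n] entries while the tail sum stops at [minn m n]; the entries
    in between vanish by the rank bound. The shift by one reconciles numbering from 1 with list
    positions. *)
Lemma sum_sigma_tail m n (A : 'M[C]_(m, n)) k :
  \sum_(k.+1 <= i < (minn m n).+1) nth 0 (singular_values A) i.-1 =
  \sum_(k <= i < n) nth 0 (singular_values A) i.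
Proof.
rewrite big_add1 /=.
have rA : (\rank A <= minn m n)%N by rewrite leq_min rank_leq_row rank_leq_col.
have [kn|nk] := leqP k (minn m n).
  rewrite [RHS](@big_cat_nat _ _ _ (minn m n)) ?geq_minr //= [X in _ + X]big_nat_cond.
  rewrite [X in _ + X]big1 ?addr0 // => i /andP[/andP[mi _] _].
  by rewrite nth_singular_values_ge_rank // (leq_trans rA).
rewrite big_geq ?(ltnW nk) // big_nat_cond big1 // => i /andP[/andP[ki _] _].
by rewrite nth_singular_values_ge_rank // (leq_trans rA) // (leq_trans (ltnW nk)).
Qed.

Lemma sum_singular_tail m n (A : 'M[C]_(m, n)) (U : 'M[C]_n) l k :
  U \is unitarymx -> A ^t* *m A = udiag U l ->
  exists S : {set 'I_n}, #|S| = minn k n /\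
    \sum_(k.+1 <= i < (minn m n).+1) nth 0 (singular_values A) i.-1 =
    \sum_(j | j \notin S) Num.sqrt (l 0 j).
Proof.
move=> hU eA; have [S [cS eS]] := sum_sort_tail (fun j => Num.sqrt (l 0 j)) k.
by exists S; split; rewrite // sum_sigma_tail (singular_values_udiag hU eA).
Qed.

Lemma tail_rect_eq0 n1 n2 k (X : rect_space R n1 n2) :
  (mrank X <= k)%N -> tail_sum k X = 0.
Proof.
move=> rX; rewrite /tail_sum /sigma /= sum_sigma_tail big_nat_cond big1 //.
move=> i /andP[/andP[ki _] _]; rewrite nth_singular_values_ge_rank //.
by rewrite mxrank_map (leq_trans rX).
Qed.

Lemma tail_herm_eq0 n k (X : herm_space R n) :
  (mrank X <= k)%N -> tail_sum k X = 0.
Proof.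
have := sum_sigma_tail (hermval X) k; rewrite minnn => e rX.
rewrite /tail_sum /sigma /= e.
rewrite big_nat_cond big1 // => i /andP[/andP[ki _] _].
by rewrite nth_singular_values_ge_rank // (leq_trans rX).
Qed.

(** Multiply [X] on the right by the orthogonal projection onto the leading right singular vectors.
    The kept and discarded parts are then orthogonal, which the rescaling in the norm ball relies
    on. *)
Lemma rect_truncation n1 n2 k (X : rect_space R n1 n2) :
  exists X' : rect_space R n1 n2,
    [/\ (mrank X' <= k)%N, inner (X - X') X' = 0 & fro (X - X') <= tail_sum k X].
Proof.
pose A : 'M[R]_(n1, n2) := X.
have sG : (A^T *m A)^T = A^T *m A by rewrite trmx_mul trmxK.
have [P [d [PP eG]]] := symmetric_spectral sG.
have PP' : P^T *m P = 1%:M by apply: mulmx1C.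
(* The eigenvalue [d 0 j] of [A^T A] is the squared length of [A] applied to the unit eigenvector
   given by row [j] of [P]. *)
have d0 j : 0 <= d 0 j.
  have : (P *m (A^T *m A) *m P^T) j j = d 0 j.
    by rewrite eG !mulmxA PP mul1mx -mulmxA PP mulmx1 mxE eqxx mulr1n.
  rewrite mulmxA -mulmxA -[P *m A^T]trmxK trmx_mul trmxK mxE => <-.
  by apply: sumr_ge0 => i _; rewrite mxE -expr2 sqr_ge0.
(* Singular values are defined over [R[i]], so the real diagonalization is carried over there. *)
pose U := map_mx (real_complex R) P.
have UT : U ^t* = map_mx (real_complex R) P^T.
  by apply/matrixP=> i j; rewrite !mxE; apply/CrealP; rewrite complex_real.
have AT : (map_mx (real_complex R) A) ^t* = map_mx (real_complex R) A^T.
  by apply/matrixP=> i j; rewrite !mxE; apply/CrealP; rewrite complex_real.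
have hU : U \is unitarymx.
  by apply/unitarymxP; rewrite UT -map_mxM PP map_mx1.
have eU : (map_mx (real_complex R) A) ^t* *m map_mx (real_complex R) A = udiag U d.
  rewrite AT -map_mxM eG !map_mxM -UT; congr (_ *m _ *m _).
  rewrite map_diag_mx; congr diag_mx; by apply/rowP => j; rewrite !mxE.
have [S [cS eS]] := sum_singular_tail k hU eU.
pose pd (e : 'I_n2 -> R) : 'M[R]_n2 := P^T *m diag_mx (\row_j e j) *m P.
have pdM e f : pd e *m pd f = pd (fun j => e j * f j).
  rewrite /pd !mulmxA -[_ *m P *m P^T]mulmxA PP mulmx1.
  rewrite -[_ *m diag_mx _ *m diag_mx _]mulmxA mulmx_diag.
  by congr (_ *m diag_mx _ *m _); apply/rowP => j; rewrite !mxE.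
have pdT e : (pd e)^T = pd e by rewrite /pd !trmx_mul trmxK tr_diag_mx mulmxA.
have pd_tr e : \tr (pd e) = \sum_j e j.
  rewrite mxtrace_mulC mulmxA PP mul1mx mxtrace_diag.
  by apply: eq_bigr => j _; rewrite mxE.
have eGd : A^T *m A = pd (d 0).
  by rewrite eG; congr (_ *m diag_mx _ *m _); apply/rowP => j; rewrite mxE.
(* [pd e] and [pd f] are complementary projections, onto the kept and the discarded eigenvectors. *)
pose e j : R := (j \in S)%:R; pose f j : R := (j \notin S)%:R.
have pd1 : pd f = 1%:M - pd e.
  rewrite -PP' -[P^T in X in X - _]mulmx1 -diag_const_mx -mulmxBl -mulmxBr -linearB /=.
  congr (_ *m diag_mx _ *m _); apply/rowP => j; rewrite !mxE /e /f.
  by case: (j \in S); rewrite ?subrr ?subr0.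
have XX' : A - A *m pd e = A *m pd f by rewrite pd1 mulmxBr mulmx1.
exists (A *m pd e); split.
- rewrite /= (leq_trans (mxrankM_maxr _ _)) // (leq_trans (mxrankM_maxl _ _)) //.
  rewrite (leq_trans (mxrankM_maxr _ _)) //.
  apply: leq_trans (geq_minl k n2); rewrite -cS.
  by apply: rank_diag_mx_le => j /negbTE jS; rewrite mxE /e jS.
- rewrite /= XX' trmx_mul pdT -mulmxA [A^T *m _]mulmxA eGd !pdM pd_tr big1 // => j _.
  by rewrite /e /f; case: (j \in S); rewrite ?mul0r ?mulr0.
- rewrite /fro /= XX' trmx_mul pdT -mulmxA [A^T *m _]mulmxA eGd !pdM pd_tr.
  rewrite /tail_sum /sigma /= eS -[leRHS]ger0_norm; last first.
    by apply: sumr_ge0 => *; exact: sqrtr_ge0.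
  rewrite -sqrtr_sqr ler_wsqrtr // (le_trans _ (sum_sqr_le _ _)) //.
  rewrite [leRHS]big_mkcond ler_sum // => j _; rewrite /f; case: ifP => jS.
    by rewrite mul1r mulr1 sqr_sqrtr.
  by rewrite mul0r.
Qed.

Definition hdiag n (U : 'M[C]_n) l : hermx R n := Hermx (udiag_hermsym U l).

Lemma hdiagB n (U : 'M[C]_n) l k : hdiag U l - hdiag U k = hdiag U (l - k).
Proof. by apply/val_inj; rewrite /= udiagB. Qed.

Lemma herm_norm_hdiag n (U : 'M[C]_n) l : U \is unitarymx ->
  herm_norm (hdiag U l) = Num.sqrt (\sum_j l 0 j ^+ 2).
Proof.
move=> hU; rewrite /herm_norm /herm_inner hermE /=; congr Num.sqrt.
rewrite udiagM // mxtrace_udiag //=.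
by apply: eq_bigr => j _; rewrite mxE expr2.
Qed.

(** For Hermitian [X], [X^* X = X^2], so the singular values are the absolute values of the
    eigenvalues; [S] collects those of largest modulus. *)
Lemma herm_spectral n k (X : hermx R n) :
  exists U l (S : {set 'I_n}), [/\ U \is unitarymx, X = hdiag U l,
    #|S| = minn k n &
    @tail_sum R (herm_space R n) k X = \sum_(j | j \notin S) `|l 0 j|].
Proof.
have hU := spectral_unitarymx (hermval X).
have eX := hermsym_udiag (hermvalP X).
set U := spectralmx _ in hU eX; set l := \row_j _ in eX.
have eG : (hermval X) ^t* *m hermval X = udiag U (\row_j l 0 j ^+ 2).
  rewrite hermE {1 2}eX; exact: udiagM.
have [S [cS eS]] := sum_singular_tail k hU eG.
exists U, l, S; split; [exact: hU | apply/val_inj; exact: eX | exact: cS |].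
rewrite minnn in eS; rewrite /tail_sum /sigma /= eS.
by apply: eq_bigr => j _; rewrite mxE sqrtr_sqr.
Qed.

Lemma psd_hdiag n (U : 'M[C]_n) (l : 'rV[R]_n) :
  (forall j, 0 <= l 0 j) -> psd (hdiag U l).
Proof.
move=> l0 v; rewrite /= udiag_quad ler0c sumr_ge0 // => j _.
by rewrite mulr_ge0 // sqnormc_ge0.
Qed.

(** The quadratic form at the eigenvector [U ^t* *m delta_mx j 0] equals the eigenvalue [l 0 j]. *)
Lemma psd_eigen_ge0 n (U : 'M[C]_n) (l : 'rV[R]_n) j : U \is unitarymx ->
  psd (hdiag U l) -> 0 <= l 0 j.
Proof.
move=> hU /(_ (U ^t* *m delta_mx j 0)); rewrite /= udiag_quad mulmxA.
rewrite (unitarymxP hU) mul1mx ler0c (bigD1 j) //= big1 ?addr0.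
  by rewrite mxE !eqxx /sqnormc /= expr0n addr0 expr1n mulr1.
by move=> i ij; rewrite mxE (negbTE ij) /sqnormc /= expr0n addr0 mulr0.
Qed.

Lemma rank_hdiag_le n (U : 'M[C]_n) (l : 'rV[R]_n) (S : {set 'I_n}) k :
  U \is unitarymx ->
  (#|S| <= k)%N -> (forall j, j \notin S -> l 0 j = 0) ->
  (\rank (hermval (hdiag U l)) <= k)%N.
Proof.
move=> hU Sk lS; rewrite rank_udiag // (leq_trans _ Sk) //; apply: subset_leq_card.
by apply/fintype.subsetP => j; rewrite inE; apply: contraR => /lS ->.
Qed.

Lemma sqrt_sum_sqr_le (I : finType) (P : pred I) (a : I -> R) :
  (forall i, P i -> 0 <= a i) ->
  Num.sqrt (\sum_(i | P i) a i ^+ 2) <= \sum_(i | P i) a i.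
Proof.
move=> a0; rewrite -[leRHS]ger0_norm ?sumr_ge0 // -sqrtr_sqr ler_wsqrtr //.
exact: sum_sqr_le.
Qed.

Lemma herm_truncation n k (X : hermx R n) :
  exists2 X' : hermx R n, (\rank (hermval X') <= k)%N &
    herm_norm (X - X') <= @tail_sum R (herm_space R n) k X.
Proof.
have [U [l [S [hU -> cS ->]]]] := herm_spectral k X.
exists (hdiag U (\row_j if j \in S then l 0 j else 0)).
  apply: (@rank_hdiag_le _ _ _ S) => //; first by rewrite cS geq_minl.
  by move=> j /negbTE jS; rewrite mxE jS.
rewrite hdiagB herm_norm_hdiag // (le_trans _ (sqrt_sum_sqr_le _)) //.
rewrite ler_wsqrtr // [leRHS]big_mkcond ler_sum // => j _; rewrite !mxE.
by case: ifP => jS /=; [rewrite subrr expr0n | rewrite subr0 real_normK ?num_real].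
Qed.

(** * Entrywise estimates and rank gaps in the Frobenius norm *)

(** Turns the entrywise l1 gap of [rank_gap] into a Frobenius gap; the summand 1 covers empty
    matrices. *)
Lemma entry_bound m n (e F : R) (x : 'I_m -> 'I_n -> R) : 0 <= F ->
  e <= \sum_i \sum_j x i j -> (forall i j, x i j <= F) ->
  e / (1 + (m * n)%:R) <= F.
Proof.
move=> F0 ex xF; rewrite ler_pdivrMr ?ltr_pwDl // (le_trans ex) //.
apply: (@le_trans _ _ (\sum_(i < m) \sum_(j < n) F)).
  by do 2 apply: ler_sum => ? _.
by rewrite !sumr_const !card_ord -mulrnA mulrDr mulr1 mulr_natr mulnC lerDr.
Qed.

Lemma le_sum_sum m n (a : 'I_m -> 'I_n -> R) i j : (forall i j, 0 <= a i j) ->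
  a i j <= \sum_i \sum_j a i j.
Proof.
move=> a0; rewrite (bigD1 i) //= (bigD1 j) //= -addrA lerDl addr_ge0 //.
  by apply: sumr_ge0.
by do 2 apply: sumr_ge0 => ? _.
Qed.

Lemma rect_innerE n1 n2 (X : rect_space R n1 n2) :
  inner X X = \sum_i \sum_j (X : 'M[R]_(n1, n2)) i j ^+ 2.
Proof.
rewrite exchange_big /=; apply: eq_bigr => j _; rewrite mxE.
by apply: eq_bigr => i _; rewrite mxE expr2.
Qed.

Lemma herm_inner_sqnormc n (X : hermx R n) :
  herm_inner X X = \sum_i \sum_j sqnormc (X i j).
Proof.
rewrite exchange_big herm_innerE; apply: eq_bigr => i _; apply: eq_bigr => j _.
by case: (X j i) => a b; rewrite /sqnormc /= mulNr opprK -!expr2.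
Qed.

Lemma entry_le_fro n1 n2 (X : rect_space R n1 n2) i j :
  `|(X : 'M[R]_(n1, n2)) i j| <= fro X.
Proof.
rewrite -sqrtr_sqr ler_wsqrtr // rect_innerE.
by apply: (le_sum_sum (a := fun i j => _)) => *; exact: sqr_ge0.
Qed.

Lemma entry_le_herm_norm n (X : hermx R n) i j :
  Num.sqrt (sqnormc (X i j)) <= herm_norm X.
Proof.
rewrite ler_wsqrtr // herm_inner_sqnormc.
by apply: (le_sum_sum (a := fun i j => _)) => *; exact: sqnormc_ge0.
Qed.

Lemma rank_gap_rect n1 n2 k (X : rect_space R n1 n2) : (k < mrank X)%N ->
  exists2 e : R, 0 < e & 
    forall Y : rect_space R n1 n2, (mrank Y <= k)%N -> e <= fro (X - Y).
Proof.
move=> /rank_gap[e e0 h]; exists (e / (1 + (n1 * n2)%:R)).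
  by rewrite divr_gt0 ?ltr_pwDl.
move=> Y /h eY; apply: entry_bound eY _; first exact: sqrtr_ge0.
by move=> i j; exact: entry_le_fro.
Qed.

Lemma rank_gap_herm n k (X : hermx R n) : (k < \rank (hermval X))%N ->
  exists2 e : R, 0 < e & forall Y : hermx R n, (\rank (hermval Y) <= k)%N ->
    e <= herm_norm (X - Y).
Proof.
(* The gap is an element of [R[i]]; being positive, it is real. *)
move=> /rank_gap[e e0 h]; have eR : e = (complex.Re e)%:C.
  by rewrite RRe_real // gtr0_real.
exists (complex.Re e / (1 + (n * n)%:R)).
  by rewrite divr_gt0 ?ltr_pwDl // -ltcR -eR.
move=> Y /h; rewrite eR => eY.
have {}eY : complex.Re e <= \sum_i \sum_j Num.sqrt (sqnormc ((X - Y) i j)).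
  rewrite -lecR (le_trans eY) // rmorph_sum /=; apply: ler_sum => i _.
  rewrite rmorph_sum /=; apply: ler_sum => j _.
  by rewrite normc_def.
apply: entry_bound eY _; first exact: sqrtr_ge0.
by move=> i j; exact: entry_le_herm_norm.
Qed.

(** * Low-rank approximation with fixed trace or fixed diagonal *)

(** Adding the discarded mass [t] to one kept eigenvalue restores the trace. The squared error is
    [t^2] there plus the discarded squares, which sum to at most [t^2]; hence the factor
    [Num.sqrt 2]. *)
Lemma density_approx n k (X : hermx R n) : (0 < k)%N ->
  psd X -> \tr (hermval X) = 1 -> exists X' : hermx R n,
    [/\ (\rank (hermval X') <= k)%N, psd X', \tr (hermval X') = 1 &
      herm_norm (X - X') <= Num.sqrt 2 * @tail_sum R (herm_space R n) k X].
Proof.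
move=> k0; have [U [l [S [hU -> cS ->]]]] := herm_spectral k X.
move=> pX; rewrite mxtrace_udiag // => /complexI l1.
have l0 j : 0 <= l 0 j by exact: psd_eigen_ge0 hU pX.
under eq_bigr do rewrite ger0_norm //.
set t := \sum_(j | _) _; have t0 : 0 <= t by exact: sumr_ge0.
(* [S] has [minn k n] elements, and trace 1 rules out [n = 0]. *)
have [j0 j0S] : exists j0, j0 \in S.
  apply/set0Pn; rewrite -card_gt0 cS leq_min k0 /= lt0n.
  by apply/eqP => n0; move: l1; subst n; rewrite big_ord0 => /eqP; rewrite eq_sym oner_eq0.
pose l' := \row_j (if j \in S then l 0 j + (if j == j0 then t else 0) else 0).
exists (hdiag U l'); split.
- apply: (@rank_hdiag_le _ _ _ S) => //; first by rewrite cS geq_minl.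
  by move=> j /negbTE jS; rewrite mxE jS.
- apply: psd_hdiag => j; rewrite mxE; case: ifP => // _.
  by rewrite addr_ge0 //; case: ifP.
- rewrite mxtrace_udiag //; congr (_%:C); rewrite -l1.
  rewrite (bigID (mem S)) [RHS](bigID (mem S)) /= -/t.
  rewrite [X in _ + X]big1 ?addr0; last first.
    by move=> j /negbTE jS; rewrite mxE jS.
  rewrite (bigD1 j0) //= [X in _ = X + _](bigD1 j0) //= mxE j0S eqxx.
  rewrite -!addrA; congr (_ + _); rewrite addrC; congr (_ + _).
  by apply: eq_bigr => j /andP[jS /negbTE jj]; rewrite mxE jS jj addr0.
- rewrite hdiagB herm_norm_hdiag // -[t in leRHS]ger0_norm // -sqrtr_sqr.
  rewrite -sqrtrM // ler_wsqrtr // (bigID (mem S)) /= mulr_natl mulr2n lerD //.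
    rewrite (bigD1 j0) //= big1 ?addr0.
      by rewrite !mxE j0S eqxx opprD addNKr sqrrN.
    by move=> j /andP[jS /negbTE jj]; rewrite !mxE jS jj addr0 subrr expr0n.
  apply: (le_trans _ (sum_sqr_le _ _)) => //; apply: ler_sum => j /negbTE jS.
  by rewrite !mxE jS subr0.
Qed.

(** At [v = e_i - W_ji e_j] the quadratic form equals [1 - |W_ij|^2]. *)
Lemma psd_unit_diag_entry n (W : hermx R n) i j : psd W ->
  (forall i, W i i = 1) -> sqnormc (W i j) <= 1.
Proof.
move=> pW W1; pose v : 'cV[C]_n := delta_mx i 0 - W j i *: delta_mx j 0.
have Wv k : ((hermval W) *m v) k 0 = W k i - W j i * W k j.
  by rewrite mulmxBr -scalemxAr -!colE !mxE.
have Wji : W j i = (W i j)^* by rewrite -[in LHS](hermE W) !mxE.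
have vE : v ^t* = delta_mx 0 i - (W j i)^* *: delta_mx 0 j.
  rewrite linearB linearZ /= map_mxB map_mxZ !trmx_delta.
  by rewrite !map_delta_mx.
have := pW v; rewrite -mulmxA vE mulmxBl -scalemxAl -!rowE !mxE.
have WvE k : \sum_j0 W k j0 * v j0 0 = ((hermval W) *m v) k 0 by rewrite mxE.
rewrite !WvE !Wv !W1 mulr1 subrr mulr0 subr0 Wji mulrC -sqr_normc -add_Re2_Im2.
by rewrite -[1 in X in X - _]/(1%:C) -rmorphB ler0c subr_ge0.
Qed.

Lemma psd_unit_diag_norm n (Z : hermx R n) : psd Z ->
  (forall i, Z i i = 1) -> herm_norm Z <= n%:R.
Proof.
move=> pZ Z1; rewrite -[leRHS]ger0_norm // -sqrtr_sqr ler_wsqrtr //.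
rewrite herm_inner_sqnormc.
apply: (@le_trans _ _ (\sum_(i < n) \sum_(j < n) 1)).
  by do 2 apply: ler_sum => ? _; exact: psd_unit_diag_entry.
by rewrite !sumr_const !card_ord -mulrnA expr2 natrM.
Qed.

Lemma hermBE n (X Y : hermx R n) i j : (X - Y) i j = X i j - Y i j.
Proof. by rewrite [LHS]mxE [X in _ + X]mxE. Qed.

Lemma real_complex_scaleK (a b : R) (z : C) : a != 0 -> b != 0 ->
  (a * b)%:C * ((a^-1)%:C * z * (b^-1)%:C) = z.
Proof.
move=> a0 b0; have -> : (a * b)%:C * ((a^-1)%:C * z * (b^-1)%:C) =
    ((a * b) * (a^-1 * b^-1))%:C * z by rewrite !rmorphM /=; ring.
have -> : a * b * (a^-1 * b^-1) = 1 by field; rewrite a0 b0.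
by rewrite rmorph1 mul1r.
Qed.

(** The difference of the unsquared sides is [(1 - x)(1 + x - y) + y(1 - y)], a sum of nonnegative
    terms. It serves with [x] and [y] the square roots of two diagonal entries. *)
Lemma prod_defect (x y : R) : 0 < x -> 0 < y -> x <= 1 -> y <= 1 ->
  (x * y - 1) ^+ 2 <= (1 - x * x + (1 - y * y)) ^+ 2.
Proof.
move=> x0 y0 x1 y1; rewrite -[leLHS]sqrrN opprB.
have xy : x * y <= 1 by rewrite mulr_ile1 // ltW.
have h : 1 - x * y <= 1 - x * x + (1 - y * y).
  rewrite -subr_ge0; set u := (X in 0 <= X).
  have -> : u = (1 - x) * (1 + x - y) + y * (1 - y) by rewrite /u; ring.
  have y2 : y <= 1 + x by rewrite (le_trans y1) // lerDl ltW.
  by rewrite addr_ge0 // mulr_ge0 ?subr_ge0 // ltW.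
by rewrite ler_pXn2r // nnegrE ?(le_trans _ h) // subr_ge0.
Qed.

(** The congruence [W = D A D] preserves positivity and does not raise the rank. Entry [(i, j)] of
    [A - W] is [(s i * s j - 1) W_ij] with [|W_ij| <= 1], and summing the bounds over all pairs
    counts each [1 - a i] exactly [2 n] times. *)
Lemma psd_unit_diag_scaling n (A : hermx R n) (a : 'I_n -> R) : psd A ->
  (forall i, A i i = (a i)%:C) -> (forall i, 0 < a i) -> (forall i, a i <= 1) ->
  exists W : hermx R n,
    [/\ (\rank (hermval W) <= \rank (hermval A))%N, psd W, (forall i, W i i = 1) &
      herm_norm (A - W) <= 2 * n%:R * \sum_i (1 - a i)].
Proof.
move=> pA Aii a0 a1; pose s i := Num.sqrt (a i).
have s0 i : 0 < s i by rewrite sqrtr_gt0.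
have s1 i : s i <= 1 by rewrite -sqrtr1 ler_wsqrtr.
have sE i : s i * s i = a i by rewrite -expr2 sqr_sqrtr // ltW.
pose D := diag_mx (\row_i ((s i)^-1)%:C).
have WE i j : (D *m hermval A *m D) i j = ((s i)^-1)%:C * A i j * ((s j)^-1)%:C.
  by rewrite mul_mx_diag mxE mul_diag_mx mxE !mxE.
have DT : D ^t* = D.
  rewrite tr_diag_mx map_diag_mx; congr diag_mx; apply/rowP => i.
  by rewrite !mxE; apply/CrealP; rewrite complex_real.
have hW : D *m hermval A *m D \is hermsymmx.
  by rewrite hermsymE; apply/eqP/esym; exact: sandwich_adj DT (hermE A).
pose W := Hermx hW.
have pW : psd W by move=> v; rewrite (sandwich_quad _ _ DT); exact: pA.
have W1 i : W i i = 1.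
  have e : (s i)^-1 * a i * (s i)^-1 = 1.
    by rewrite -sE; field; rewrite gt_eqF.
  by rewrite WE Aii -!rmorphM /= e.
exists W; split=> //.
  by rewrite (leq_trans (mxrankM_maxl _ _)) // mxrankM_maxr.
have AWE i j : sqnormc ((A - W) i j) <= (1 - a i + (1 - a j)) ^+ 2.
  have -> : (A - W) i j = (s i * s j - 1)%:C * W i j.
    rewrite hermBE rmorphB rmorph1 mulrBl mul1r; congr (_ - _).
    by rewrite WE real_complex_scaleK ?gt_eqF.
  rewrite sqnormcZ (@le_trans _ _ ((s i * s j - 1) ^+ 2)) //.
    by rewrite ler_piMr ?sqr_ge0 // psd_unit_diag_entry.
  have := s1 i; have := s1 j; have := s0 i; have := s0 j.
  by rewrite -!sE => y0 x0 y1 x1; exact: prod_defect.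
apply: (@le_trans _ _ (\sum_i \sum_j (1 - a i + (1 - a j)))).
  rewrite pair_bigA (le_trans _ (sqrt_sum_sqr_le _)) //=; last first.
    by move=> p _; rewrite addr_ge0 // subr_ge0.
  by rewrite ler_wsqrtr // herm_inner_sqnormc pair_bigA ler_sum.
under eq_bigr do rewrite big_split /= sumr_const card_ord.
rewrite big_split /= sumrMnl sumr_const card_ord -mulr2n.
by rewrite -mulrA mulr_natl mulr_natl.
Qed.

Lemma correlation_approx n k (X Y : hermx R n) :
  psd X -> (forall i, X i i = 1) ->
  psd Y -> (forall i, Y i i = 1) -> (\rank (hermval Y) <= k)%N ->
  exists X' : hermx R n,
    [/\ (\rank (hermval X') <= k)%N, psd X', (forall i, X' i i = 1) &
      herm_norm (X - X') <= (1 + 2 * n%:R) * @tail_sum R (herm_space R n) k X].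
Proof.
move=> pX X1 pY Y1 rY; have [U [l [S [hU eX cS ->]]]] := herm_spectral k X.
have pU : psd (hdiag U l) by rewrite -eX.
have l0 j : 0 <= l 0 j by exact: psd_eigen_ge0 hU pU.
under eq_bigr do rewrite ger0_norm //.
set t := \sum_(j | _) _; have t0 : 0 <= t by exact: sumr_ge0.
pose l' := \row_j (if j \in S then l 0 j else 0).
(* [delta i] is the diagonal entry at [i] of the discarded part [X - A]; these entries sum to its
   trace [t]. *)
pose delta i := \sum_(j | j \notin S) l 0 j * sqnormc (U j i).
have delta0 i : 0 <= delta i.
  by apply: sumr_ge0 => j _; rewrite mulr_ge0 // sqnormc_ge0.
have sum_delta : \sum_i delta i = t.
  rewrite exchange_big /=; apply: eq_bigr => j _; rewrite -mulr_sumr.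
  have -> : \sum_i sqnormc (U j i) = 1; last by rewrite mulr1.
  apply: complexI; rewrite rmorph_sum /=.
  transitivity ((U *m U ^t*) j j); last by rewrite (unitarymxP hU) mxE eqxx.
  rewrite mxE; apply: eq_bigr => i _.
  by rewrite add_Re2_Im2 sqr_normc !mxE.
pose A := hdiag U l'.
have sumU i : \sum_j l 0 j * sqnormc (U j i) = 1.
  by apply: complexI; rewrite -udiag_diagE -[RHS](X1 i) eX.
have Aii i : A i i = (1 - delta i)%:C.
  rewrite udiag_diagE -(sumU i); congr (_%:C).
  rewrite [in RHS](bigID (mem S)) /= -/(delta i) addrK.
  rewrite (bigID (mem S)) /= [X in _ + X]big1 ?addr0.
    by apply: eq_bigr => j jS; rewrite mxE jS.
  by move=> j /negbTE jS; rewrite mxE jS mul0r.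
have delta1 i : delta i <= 1.
  rewrite -(sumU i) [leRHS](bigID (mem S)) /= -/(delta i) lerDr sumr_ge0 // => j _.
  by rewrite mulr_ge0 // sqnormc_ge0.
have XA : herm_norm (X - A) <= t.
  rewrite eX hdiagB herm_norm_hdiag // (le_trans _ (sqrt_sum_sqr_le _)) //.
  rewrite ler_wsqrtr // [leRHS]big_mkcond ler_sum // => j _; rewrite !mxE.
  by case: ifP => jS /=; rewrite ?subrr ?expr0n ?subr0.
(* If [A i i = 0] then [t >= 1], while any two matrices of the feasible set are at most [2 n] apart,
   so [Y] is close enough. *)
have [[i di]|dlt] := pselect (exists i, delta i = 1).
  exists Y; split=> //.
  have t1 : 1 <= t.
    by rewrite -sum_delta (bigD1 i) //= di lerDl sumr_ge0.
  apply: (@le_trans _ _ (2 * n%:R)).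
    rewrite (le_trans (ler_herm_normD _ _)) // -scaleN1r herm_normZ normrN1 mul1r.
    by rewrite mulr2n mulrDl !mul1r lerD // psd_unit_diag_norm.
  rewrite (@le_trans _ _ (1 + 2 * n%:R)) ?lerDr // ler_peMr // addr_ge0 //.
have d1 i : 0 < 1 - delta i.
  rewrite subr_gt0 lt_neqAle delta1 andbT; apply/eqP => di; apply: dlt.
  by exists i.
have pA : psd A by apply: psd_hdiag => j; rewrite mxE; case: ifP.
have rA : (\rank (hermval A) <= k)%N.
  apply: (@rank_hdiag_le _ _ _ S) => //; first by rewrite cS geq_minl.
  by move=> j /negbTE jS; rewrite mxE jS.
have [|W [rW pW W1 AW]] := psd_unit_diag_scaling pA Aii d1.
  by move=> i; rewrite gerBl.
exists W; split=> //; first exact: leq_trans rW rA.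
(* Truncation costs [t] and rescaling costs [2 n t]. *)
have -> : X - W = (X - A) + (A - W) by rewrite addrA subrK.
rewrite (le_trans (ler_herm_normD _ _)) // mulrDl mul1r lerD //.
rewrite (le_trans AW) // -sum_delta le_eqVlt; apply/orP; left; apply/eqP.
by congr (_ * _); apply: eq_bigr => i _; rewrite subKr.
Qed.

End Truncation.

(** * The error bound *)

Local Open Scope classical_set_scope.

(** An [mxspace] is bare data; these are the facts the general argument draws on. [nbhs_fro] links
    the inner product to the topology, which in the rectangular case comes from the max-norm. *)
Record frobenius_space (R : realType) (V : mxspace R) : Prop := FrobeniusSpace {
  inner_sym : forall X Y : V, inner X Y = inner Y X ;
  inner_addl : forall X Y Z : V, inner (X + Y) Z = inner X Z + inner Y Z ;
  inner_scalel : forall (a : R) (X Y : V), inner (a *: X) Y = a * inner X Y ;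
  inner_ge0 : forall X : V, 0 <= inner X X ;
  inner_eq0 : forall X : V, inner X X = 0 -> X = 0 ;
  nbhs_fro : forall (X : V) (e : R), 0 < e -> nbhs X [set Y | fro (X - Y) < e] ;
  mrank_gap : forall (X : V) k, (k < mrank X)%N ->
    exists2 e : R, 0 < e & forall Y : V, (mrank Y <= k)%N -> e <= fro (X - Y) ;
  tail_sum_eq0 : forall (X : V) k, (mrank X <= k)%N -> tail_sum k X = 0 ;
  truncation : forall (X : V) k,
    exists2 Y : V, (mrank Y <= k)%N & fro (X - Y) <= tail_sum k X }.

(** * Geometry of the Frobenius norm *)

Section FrobeniusSpace.
Variables (R : realType) (V : mxspace R).
Implicit Types X Y Z : V.
Hypothesis VF : frobenius_space V.

Lemma fro_ge0 X : 0 <= fro X. Proof. exact: sqrtr_ge0. Qed.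

Lemma inner_addr X Y Z : inner X (Y + Z) = inner X Y + inner X Z.
Proof. by rewrite inner_sym // inner_addl // !(inner_sym VF X). Qed.

Lemma inner_scaler (a : R) X Y : inner X (a *: Y) = a * inner X Y.
Proof. by rewrite inner_sym // inner_scalel // (inner_sym VF X). Qed.

Lemma fro_scale (a : R) X : fro (a *: X) = `|a| * fro X.
Proof.
by rewrite /fro inner_scalel // inner_scaler mulrA -expr2 sqrtrM ?sqr_ge0 // sqrtr_sqr.
Qed.

Lemma fro_sym X Y : fro (X - Y) = fro (Y - X).
Proof. by rewrite -opprB -scaleN1r fro_scale normrN1 mul1r. Qed.

Lemma fro0 : fro (0 : V) = 0.
Proof. by rewrite -(scale0r 0) fro_scale normr0 mul0r. Qed.

Lemma fro_eq0 X : fro X = 0 -> X = 0.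
Proof.
move=> /eqP; rewrite sqrtr_eq0 => X0; apply: (inner_eq0 VF); apply/eqP.
by rewrite eq_le X0 inner_ge0.
Qed.

Lemma inner_cauchy X Y : inner X Y <= fro X * fro Y.
Proof.
have [Y0|Y0] := eqVneq (inner Y Y) 0.
  rewrite (inner_eq0 VF Y0) -(scale0r 0) inner_scaler mul0r.
  by rewrite mulr_ge0 ?fro_ge0.
have Ygt0 : 0 < inner Y Y by rewrite lt_neqAle eq_sym Y0 inner_ge0.
rewrite -sqrtrM ?inner_ge0 // (le_trans (ler_norm _)) // -sqrtr_sqr ler_wsqrtr //.
(* The squared norm of this vector is [|Y|^2 (|X|^2 |Y|^2 - <X, Y>^2)]. *)
have := inner_ge0 VF (inner Y Y *: X + (- inner X Y) *: Y).
rewrite !(inner_addl VF, inner_addr, inner_scalel VF, inner_scaler) (inner_sym VF Y X).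
set x := inner X X; set y := inner X Y; set z := inner Y Y.
rewrite (_ : _ + _ = z * (x * z - y ^+ 2)); last by ring.
by rewrite pmulr_rge0 // subr_ge0.
Qed.

Lemma fro_add X Y : fro (X + Y) <= fro X + fro Y.
Proof.
have nD : 0 <= fro X + fro Y by rewrite addr_ge0 ?fro_ge0.
rewrite -(ler_pXn2r (_ : 0 < 2)%N) ?nnegrE ?fro_ge0 //.
rewrite sqrrD !sqr_sqrtr ?inner_ge0 // inner_addl // !inner_addr (inner_sym VF Y X).
rewrite addrA lerD2r -addrA lerD2l -mulr2n lerMn2r.
exact: inner_cauchy.
Qed.

Lemma fro_triangle Y X Z : fro (X - Z) <= fro (X - Y) + fro (Y - Z).
Proof. by rewrite (le_trans _ (fro_add _ _)) // addrA subrK. Qed.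

Lemma fro_pythagoras X Y (a : R) : inner X Y = 0 ->
  inner (X + a *: Y) (X + a *: Y) = fro X ^+ 2 + (a * fro Y) ^+ 2.
Proof.
move=> XY0; rewrite inner_addl // !inner_addr inner_scalel // !inner_scaler.
rewrite inner_scalel // (inner_sym VF Y X) XY0 exprMn !sqr_sqrtr ?inner_ge0 //.
ring.
Qed.

(** * From calmness to a linear bound on the distance to the feasible set *)

Lemma tail_sum_ge0 k X : 0 <= tail_sum k X.
Proof. by have [Y _] := truncation VF X k; apply: le_trans (fro_ge0 _). Qed.

(** When the tail vanishes, [X] coincides with its truncation and so has rank at most [k]. *)
Lemma Gamma0E k (Omega : set V) : Gamma k Omega 0 = feasible k Omega.
Proof.
apply/seteqP; split=> X [OX]; last by move=> rX; split=> //; exact: tail_sum_eq0.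
move=> t0; split=> //; have [Y rY] := truncation VF X k.
rewrite t0 => XY; suff -> : X = Y by [].
apply/eqP; rewrite -subr_eq0; apply/eqP/fro_eq0/eqP.
by rewrite eq_le XY fro_ge0.
Qed.

Lemma calm_error_bound k (Omega : set V) : compact Omega ->
  feasible k Omega !=set0 ->
  (forall X, Gamma k Omega 0 X -> calm_at (Gamma k Omega) 0 X) ->
  exists2 c : R, 0 < c & forall X, Omega X ->
    exists2 Y, feasible k Omega Y & fro (X - Y) <= c * tail_sum k X.
Proof.
move=> /compact_near_coveringP cO [Y0 FY0] calm.
pose P (c : R) X := Omega X ->
  exists2 Y, feasible k Omega Y & fro (X - Y) <= c * tail_sum k X.
suff : \forall c \near +oo, Omega `<=` P c.
  move=> nP; have : \forall c \near +oo, (0 < c) /\ Omega `<=` P c.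
    by near=> c; split; near: c => //; exact: nbhs_pinfty_gt.
  by move/filter_ex => [c [c0 h]]; exists c => // X OX; exact: h.
(* By compactness it is enough to treat, for each [X] in [Omega], all [X'] near [X] and all large
   [c]. If the rank exceeds [k], the tail stays above [e / 2] near [X], so a large [c] makes the
   fixed point [Y0] acceptable. *)
apply: cO => X OX; have [rX|rX] := leqP (mrank X) k; last first.
  have [e e0 gap] := mrank_gap VF rX.
  have e2 : 0 < e / 2 by rewrite divr_gt0.
  near=> X' c => OX'; exists Y0 => //.
  have XX' : fro (X - X') < e / 2 by near: X'; exact: nbhs_fro.
  have tl : e / 2 <= tail_sum k X'.
    have [Y rY] := truncation VF X' k; apply: le_trans.
    have := gap Y rY; have := fro_triangle X' X Y; lra.
  have c0 : 0 <= c by near: c; exact: nbhs_pinfty_ge.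
  apply: (@le_trans _ _ (e / 2 + fro (X - Y0))).
    have := fro_triangle X X' Y0; rewrite (fro_sym X' X); lra.
  apply: (@le_trans _ _ (c * (e / 2))); last by rewrite ler_wpM2l.
  rewrite -ler_pdivrMr //; near: c; exact: nbhs_pinfty_ge.
have FX : feasible k Omega X by [].
have [|alpha alpha0 [W [Q [W0 QX hW]]]] := calm X; first by rewrite Gamma0E.
have [/= d d0 hd] := W0.
near=> X' c => /= OX'.
have t0 := tail_sum_ge0 k X'.
(* Within the radius [d] calmness supplies the point. *)
have [td|td] := ltP (tail_sum k X') d.
  have QX' : Q X' by near: X'.
  have Wt : W (tail_sum k X').
    by apply: hd; rewrite /= sub0r normrN ger0_norm.
  have [] := hW _ Wt X'; first by split.
  move=> Y; rewrite Gamma0E => FY [B /= B1 eX']; exists Y => //.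
  have -> : X' - Y = (alpha * `|tail_sum k X' - 0|) *: B.
    by rewrite -[in LHS]eX' addrC addKr.
  rewrite fro_scale subr0 (ger0_norm t0) ger0_norm ?mulr_ge0 //.
  apply: (@le_trans _ _ (alpha * tail_sum k X' * 1)).
    by rewrite ler_wpM2l // mulr_ge0.
  by rewrite mulr1 ler_wpM2r //; near: c; exact: nbhs_pinfty_ge.
(* The tail is at least [d] here, so [X] itself, at distance below 1, works once [c >= 1 / d]. *)
exists X => //; rewrite fro_sym.
apply: (@le_trans _ _ 1).
  by apply: ltW; near: X'; exact: nbhs_fro.
apply: (@le_trans _ _ (c * d)).
  by rewrite -ler_pdivrMr //; near: c; exact: nbhs_pinfty_ge.
rewrite ler_wpM2l //; near: c; exact: nbhs_pinfty_ge.
Unshelve. all: end_near. Qed.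

(** * Convexity, growth and the gradient *)

Section Minimizers.
Variables (f : V -> R) (df : V -> V) (A : set V).
Hypothesis fconvex : convex_function setT f.
Hypothesis fsmooth : smooth_with_gradient f df.
Hypothesis growth : (0 < growth_modulus f df A)%E.

(** Convexity bounds the difference quotients of [f] at [Z] towards [Y], for steps [h] in []0, 1]],
    by [f Y - f Z]; the derivative is their limit. *)
Lemma gradient_inequality Y Z : f Z + inner (df Z) (Y - Z) <= f Y.
Proof.
have [dfZ dfE] := fsmooth.1 Z.
rewrite -dfE -(deriveE _ dfZ) addrC -lerBrDr.
have dv : derivable f Z (Y - Z) by exact: diff_derivable.
apply: (cvgr_to_le (cvg_dnbhs_at_right dv)).
near=> h => /=.
have h0 : 0 < h by near: h; exact: nbhs_right_gt.
have h1 : h <= 1 by near: h; exact: nbhs_right_le.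
have cvx : f (h *: Y + (1 - h) *: Z) <= h * f Y + (1 - h) * f Z.
  by apply: (fconvex (Itv01 (ltW h0) h1)); rewrite in_setE.
have -> : h *: (Y - Z) + Z = h *: Y + (1 - h) *: Z.
  by rewrite scalerBr scalerBl scale1r -addrA [- _ + _]addrC.
rewrite [_ *: _]mulrC ler_pdivrMr //; lra.
Unshelve. all: end_near. Qed.

Lemma growth_estimate Y Z : A Z -> minimizers f A Y ->
  ((fro (Z - Y))%:E <= (growth_modulus f df A)^-1 * (fro (df Z - df Y))%:E)%E.
Proof.
move=> AZ mY; have [->|ZY] := eqVneq Z Y.
  by rewrite !subrr fro0 mule_ge0 // inve_ge0 ltW.
have n0 : 0 < fro (Z - Y).
  rewrite lt0r fro_ge0 andbT; apply: contra ZY => /eqP/fro_eq0/eqP.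
  by rewrite subr_eq0.
set t := (f Z - f Y - inner (df Y) (Z - Y)) / fro (Z - Y) ^+ 2.
have gt : (growth_modulus f df A <= t%:E)%E.
  apply: ereal_inf_lbound; exists Z, Y; split=> //; exact/eqP.
(* Multiplied by [|Z - Y|], the left side is the numerator of [t], bounded by [<df Z - df Y, Z - Y>]
   through the gradient inequality at [Z]. *)
have tn : t * fro (Z - Y) <= fro (df Z - df Y).
  rewrite -(ler_pM2r n0) -mulrA -expr2 /t divfK; last by rewrite expf_neq0 // gt_eqF.
  rewrite (le_trans _ (inner_cauchy _ _)) //.
  have := gradient_inequality Y Z.
  rewrite -[Y - Z]opprB -[- (Z - Y)]scaleN1r inner_scaler.
  rewrite -[- df Y]scaleN1r inner_addl // inner_scalel //; lra.
(* Being positive and at most the finite [t], the modulus is a real number. *)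
case: (growth_modulus f df A) growth gt => [r| |] //; rewrite lte_fin lee_fin => r0 rt.
rewrite inver gt_eqF // -EFinM lee_fin mulrC ler_pdivlMr //.
by rewrite (le_trans _ tn) // mulrC ler_wpM2r // ltW.
Qed.

End Minimizers.

(** Since the projection [Z] is at least as close to [X] as any feasible point, each constant in the
    theorem reduces to exhibiting one feasible point within [c * tail_sum k X]. *)
Lemma error_bound_of_approx (f : V -> R) df k (Omega : set V) c :
  convex_function setT f -> smooth_with_gradient f df ->
  (0 < growth_modulus f df (feasible k Omega))%E ->
  (forall X, Omega X ->
     exists2 Y, feasible k Omega Y & fro (X - Y) <= c * tail_sum k X) ->
  error_bound f df k Omega c.
Proof.
move=> fc fs growth approx F Fstar X Z Y OX [FZ Zmin] mY.
apply: (@le_trans _ _ (fro (X - Z) + fro (Z - Y))%:E).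
  rewrite lee_fin (le_trans _ (fro_triangle _ _ _)) //; apply: ge_inf; last by exists Y.
  by exists 0 => _ [W _ <-]; exact: fro_ge0.
rewrite EFinD leeD //; last exact: growth_estimate.
have [W FW XW] := approx X OX.
by rewrite lee_fin (le_trans (Zmin W FW)).
Qed.

End FrobeniusSpace.

(** * The two matrix spaces and the norm ball *)

Section Instances.
Variable R : realType.

Lemma rect_frobenius n1 n2 : frobenius_space (rect_space R n1 n2).
Proof.
split.
- by move=> X Y /=; rewrite -[LHS]mxtrace_tr trmx_mul trmxK.
- by move=> X Y Z /=; rewrite linearD mulmxDl mxtraceD.
- by move=> a X Y /=; rewrite linearZ -scalemxAl mxtraceZ.
- by move=> X; rewrite rect_innerE; do 2 apply: sumr_ge0 => ? _; exact: sqr_ge0.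
- move=> X X0; apply/matrixP => i j; rewrite mxE; apply/normr0_eq0/eqP.
  rewrite eq_le normr_ge0 andbT (le_trans (entry_le_fro _ _ _)) //.
  by rewrite /fro X0 sqrtr0.
(* In the max-norm ball of radius [e / c] the moduli of the entries sum to at most
   [n1 n2 e / c < e], and this sum dominates the Frobenius norm. *)
- move=> X e e0; pose c : R := 1 + (n1 * n2)%:R.
  have c0 : 0 < c by rewrite ltr_pwDl.
  apply/nbhs_ballP; exists (e / c); first by rewrite /= divr_gt0.
  move=> Y XY /=; have {}XY i j : `|(X - Y : 'M[R]_(n1, n2)) i j| < e / c.
    by have [_ /(_ i j)] := XY; rewrite /ball /= !mxE.
  apply: (@le_lt_trans _ _ (\sum_i \sum_j `|(X - Y : 'M[R]_(n1, n2)) i j|)).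
    rewrite /fro rect_innerE pair_bigA pair_bigA /=.
    under eq_bigr do rewrite -real_normK ?num_real //.
    exact: sqrt_sum_sqr_le.
  apply: (@le_lt_trans _ _ (\sum_(i < n1) \sum_(j < n2) (e / c))).
    by do 2 apply: ler_sum => ? _; exact: ltW.
  rewrite !sumr_const !card_ord -mulrnA mulnC -mulr_natr.
  by rewrite mulrAC ltr_pdivrMr // ltr_pM2l // ltrDr.
- by move=> X k; exact: rank_gap_rect.
- by move=> X k; exact: tail_rect_eq0.
- by move=> X k; have [Y [rY _ XY]] := rect_truncation k X; exists Y.
Qed.

Lemma herm_frobenius n : frobenius_space (herm_space R n).
Proof.
split.
- exact: herm_innerC.
- exact: herm_innerDl.
- exact: herm_innerZl.
- exact: herm_inner_ge0.
- exact: herm_inner_eq0.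
- by move=> X e e0; apply/nbhs_normP; exists e.
- by move=> X k; exact: rank_gap_herm.
- by move=> X k; exact: tail_herm_eq0.
- by move=> X k; exact: herm_truncation.
Qed.

(** If the truncation [Y] leaves the ball, it is scaled by [t = gamma / N Y]. Then
    [(1 - t) N Y = N Y - gamma <= N (X - Y)], so [(1 - t) |Y| <= (cu / cl) |X - Y|]; orthogonality
    of [X - Y] and [Y] gives the constant by Pythagoras. *)
Lemma norm_ball_approx n1 n2 k (N : 'M[R]_(n1, n2) -> R) (gamma cl cu : R)
    (X : rect_space R n1 n2) :
  is_norm N -> 0 < gamma -> 0 < cl -> 0 < cu ->
  (forall X : rect_space R n1 n2, cl * fro X <= N X /\ N X <= cu * fro X) ->
  N X <= gamma ->
  exists2 Y : rect_space R n1 n2, N Y <= gamma /\ (mrank Y <= k)%N &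
    fro (X - Y) <= Num.sqrt (1 + cu ^+ 2 / cl ^+ 2) * tail_sum k X.
Proof.
move=> [ND NZ _] g0 cl0 cu0 Nfro NX.
have [Y [rY XY0 XYt]] := rect_truncation k X.
have VF := rect_frobenius n1 n2.
set c := Num.sqrt _.
have c1 : 1 <= c by rewrite -sqrtr1 ler_wsqrtr // lerDl divr_ge0 // sqr_ge0.
have XYc : fro (X - Y) <= c * tail_sum k X.
  by rewrite (le_trans XYt) // ler_peMl // (tail_sum_ge0 VF).
have [NY|NY] := leP (N Y) gamma; first by exists Y.
pose t := gamma / N Y.
have NY0 : 0 < N Y by exact: lt_trans NY.
have t0 : 0 < t by rewrite divr_gt0.
have t1 : t < 1 by rewrite ltr_pdivrMr ?mul1r.
exists (t *: Y).
  split; first by rewrite NZ gtr0_norm // divfK // gt_eqF.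
  by rewrite /= (leq_trans (mxrank_scale _ _)).
have XtY : inner (X - t *: Y) (X - t *: Y) = fro (X - Y) ^+ 2 + ((1 - t) * fro Y) ^+ 2.
  have -> : X - t *: Y = (X - Y) + (1 - t) *: Y.
    by rewrite scalerBl scale1r addrA subrK.
  exact: fro_pythagoras.
have tY : (1 - t) * fro Y <= cu / cl * fro (X - Y).
  have h1 : (1 - t) * (cl * fro Y) <= cu * fro (X - Y).
    apply: (@le_trans _ _ ((1 - t) * N Y)).
      by apply: ler_wpM2l; [rewrite subr_ge0 ltW | exact: (Nfro Y).1].
    rewrite mulrBl mul1r divfK ?gt_eqF // (@le_trans _ _ (N Y - N X)) ?lerB //.
    rewrite lerBlDr (@le_trans _ _ (N (X - Y) + N X)) //; last first.
      by rewrite lerD2r; exact: (Nfro _).2.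
    have -> : N (X - Y) = N (Y - X).
      by rewrite -[in LHS]opprB -scaleN1r NZ normrN1 mul1r.
    by rewrite -{1}(subrK X Y) ND.
  by rewrite mulrAC ler_pdivlMr // -mulrA [fro Y * _]mulrC.
rewrite (@le_trans _ _ (c * fro (X - Y))) ?ler_wpM2l ?sqrtr_ge0 //.
rewrite [leLHS]/fro XtY -[fro (X - Y) in leRHS]ger0_norm ?sqrtr_ge0 // -sqrtr_sqr.
rewrite -sqrtrM; last by rewrite addr_ge0 // divr_ge0 // sqr_ge0.
rewrite ler_wsqrtr // [leRHS]mulrDl mul1r lerD2l -expr_div_n -exprMn.
have cul : 0 <= cu / cl by rewrite divr_ge0 // ltW.
by rewrite ler_pXn2r // nnegrE mulr_ge0 ?sqrtr_ge0 // subr_ge0 ltW.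
Qed.

End Instances.

Theorem theorem2p2 (R : realType) :
  (forall (n1 n2 kappa : nat) (Omega : set (rect_space R n1 n2))
          (f : rect_space R n1 n2 -> R)
          (df : rect_space R n1 n2 -> rect_space R n1 n2),
     (0 < kappa)%N ->
     convex_set Omega -> compact Omega ->
     feasible kappa Omega !=set0 ->
     (forall X, Gamma kappa Omega 0 X -> calm_at (Gamma kappa Omega) 0 X) ->
     convex_function setT f -> smooth_with_gradient f df ->
     (0 < growth_modulus f df (feasible kappa Omega))%E ->
     (exists2 c : R, 0 < c & error_bound f df kappa Omega c) /\
     (forall (N : 'M[R]_(n1, n2) -> R) (gamma cl cu : R),
        is_norm N -> 0 < gamma -> 0 < cl -> 0 < cu ->
        (forall X : rect_space R n1 n2,
           cl * fro X <= N X /\ N X <= cu * fro X) ->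
        Omega = [set X | N X <= gamma] ->
        error_bound f df kappa Omega (Num.sqrt (1 + cu ^+ 2 / cl ^+ 2))))
  /\
  (forall (n kappa : nat) (Omega : set (herm_space R n))
          (f : herm_space R n -> R)
          (df : herm_space R n -> herm_space R n),
     (0 < kappa)%N ->
     convex_set Omega -> compact Omega ->
     feasible kappa Omega !=set0 ->
     (forall X, Gamma kappa Omega 0 X -> calm_at (Gamma kappa Omega) 0 X) ->
     convex_function setT f -> smooth_with_gradient f df ->
     (0 < growth_modulus f df (feasible kappa Omega))%E ->
     [/\ exists2 c : R, 0 < c & error_bound f df kappa Omega c,
         Omega = [set X : hermx R n | psd X /\ \tr (hermval X) = 1] ->
           error_bound f df kappa Omega (Num.sqrt 2) &
         Omega = [set X : hermx R n | psd X /\ forall i, hermval X i i = 1] ->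
           error_bound f df kappa Omega (1 + 2 * n%:R)]).
Proof.
split=> [n1 n2 k Omega f df k0 _ cO neF calm fc fs growth
        |n k Omega f df k0 _ cO neF calm fc fs growth].
  have VF := rect_frobenius R n1 n2; split.
    have [c c0 h] := calm_error_bound VF cO neF calm; exists c => //.
    exact: (error_bound_of_approx VF).
  move=> N gamma cl cu hN g0 cl0 cu0 Nfro eO; apply: (error_bound_of_approx VF) => //.
  move=> X; rewrite eO => NX.
  have [Y [NY rY] XY] := norm_ball_approx k hN g0 cl0 cu0 Nfro NX.
  by exists Y.
have VF := herm_frobenius R n; split.
- have [c c0 h] := calm_error_bound VF cO neF calm; exists c => //.
  exact: (error_bound_of_approx VF).
- move=> eO; apply: (error_bound_of_approx VF) => // X; rewrite eO => -[pX tX].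
  by have [Y [rY pY tY XY]] := density_approx k0 pX tX; exists Y.
- move=> eO; apply: (error_bound_of_approx VF) => // X; rewrite eO => -[pX X1].
  (* A feasible point is the fallback when a diagonal entry of the truncation vanishes. *)
  have [Z [+ rZ]] := neF; rewrite eO => -[pZ Z1].
  by have [Y [rY pY Y1 XY]] := correlation_approx pX X1 pZ Z1 rZ; exists Y.
Qed.
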